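(* Let $p$ be a prime with $p\equiv 3\pmod 8$, let $s\ge 1$, $q=p^s$, and let $m\ge 3$ be an integer with $2^{m}\mid(q-1)$ but $2^{m+1}\nmid(q-1)$. Let $n\ge 1$ and let $N$ be the number of $(x_1,\dots,x_n)\in\mathbb F_q^n$ with $x_1^{2^m}+\dots+x_n^{2^m}=0$. For $r=2,3,\dots,m$ let $A_r,B_r$ be integers with $$p^{s/2^{r-2}}=A_r^2+2B_r^2,\qquad A_r\equiv -1\pmod 4,\qquad p\nmid A_r.$$ If $m=3$ then \begin{align*} N=\,&q^{n-1}+\frac{q-1}{8q}\Bigl[2\cdot\left((-q^{\frac12}+4B_3q^{\frac14}i)^n+(-q^{\frac12}-4B_3q^{\frac14}i)^n\right)+2\cdot 3^nq^{\frac n2}\\ &+\left(-q^{\frac12}+4A_3q^{\frac14}i\right)^n+\left(-q^{\frac12}-4A_3q^{\frac14}i\right)^n\Bigr]. \end{align*} If $m=4$ then \begin{align*} N=\,&q^{n-1}+\frac{q-1}{16q}\Bigl[4\cdot\left((q^{\frac12}+4B_3q^{\frac14})^n+(q^{\frac12}-4B_3q^{\frac14})^n\right)\\ &+2\cdot\left((q^{\frac12}+8B_4q^{\frac38}i)^n+(q^{\frac12}-8B_4q^{\frac38}i)^n\right)+2\cdot\left(-3q^{\frac12}-4A_3q^{\frac14}\right)^n\\ &+\left(-3q^{\frac12}+4A_3q^{\frac14}+8A_4q^{\frac38}i\right)^n+\left(-3q^{\frac12}+4A_3q^{\frac14}-8A_4q^{\frac38}i\right)^n\Bigr]. \end{align*}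 If $m\ge 5$ then \begin{align*} N=\,&q^{n-1}+\frac{q-1}{2^mq}\Bigl[2^{m-2}\cdot\Bigl((q^{\frac12}+4B_3q^{\frac14})^n+(q^{\frac12}-4B_3q^{\frac14})^n\Bigr)\\ &+2^{m-3}\cdot\Bigl((q^{\frac12}+8B_4q^{\frac38})^n+(q^{\frac12}-8B_4q^{\frac38})^n\Bigr)\\ &+\sum_{t=2}^{m-4}2^{m-t-2}\Bigl((-3q^{\frac12}+\sum_{r=3}^t 2^{r-1}A_rq^{\frac{2^{r-2}-1}{2^{r-1}}}-2^t A_{t+1}q^{\frac{2^{t-1}-1}{2^t}}+2^{t+2} B_{t+3}q^{\frac{2^{t+1}-1}{2^{t+2}}})^n\\ &\qquad+(-3q^{\frac12}+\sum_{r=3}^t 2^{r-1}A_rq^{\frac{2^{r-2}-1}{2^{r-1}}}-2^t A_{t+1}q^{\frac{2^{t-1}-1}{2^t}}-2^{t+2} B_{t+3}q^{\frac{2^{t+1}-1}{2^{t+2}}})^n\Bigr)\\ &+2\cdot\Bigl((-3q^{\frac 12}+\sum_{r=3}^{m-3} 2^{r-1}A_rq^{\frac{2^{r-2}-1}{2^{r-1}}}-2^{m-3} A_{m-2}q^{\frac{2^{m-4}-1}{2^{m-3}}}+2^{m-1}B_mq^{\frac{2^{m-2}-1}{2^{m-1}}}i)^n\\ &\qquad+(-3q^{\frac 12}+\sum_{r=3}^{m-3} 2^{r-1}A_rq^{\frac{2^{r-2}-1}{2^{r-1}}}-2^{m-3} A_{m-2}q^{\frac{2^{m-4}-1}{2^{m-3}}}-2^{m-1}B_mq^{\frac{2^{m-2}-1}{2^{m-1}}}i)^n\Bigr)\\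 &+2\cdot\Bigl(-3q^{\frac 12}+\sum_{r=3}^{m-2} 2^{r-1}A_rq^{\frac{2^{r-2}-1}{2^{r-1}}}-2^{m-2} A_{m-1}q^{\frac{2^{m-3}-1}{2^{m-2}}}\Bigr)^n\\ &+\Bigl(-3q^{\frac 12}+\sum_{r=3}^{m-1}2^{r-1}A_r q^{\frac{2^{r-2}-1}{2^{r-1}}}+2^{m-1}A_m q^{\frac{2^{m-2}-1}{2^{m-1}}}i\Bigr)^n\\ &+\Bigl(-3q^{\frac 12}+\sum_{r=3}^{m-1}2^{r-1}A_r q^{\frac{2^{r-2}-1}{2^{r-1}}}-2^{m-1}A_m q^{\frac{2^{m-2}-1}{2^{m-1}}}i\Bigr)^n\Bigr]. \end{align*}
   Context: Here $i=\sqrt{-1}$. Powers $q^{a}$ with rational $a$ denote positive real powers. Empty sums are zero. Under the hypotheses, $2^{r-2}\mid s$ for $r\le m$, so $p^{s/2^{r-2}}$ is an integer; the conditions determine $A_r$ uniquely and $B_r$ up to sign, and the formula holds for either choice of signs. *)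

(* Defs.v *)
From HB Require Import structures.
From mathcomp Require Import all_boot all_order all_algebra.
From mathcomp Require Import algC.
Set Implicit Arguments. Unset Strict Implicit. Unset Printing Implicit Defensive.
Import Order.TTheory GRing.Theory Num.Theory.
Local Open Scope ring_scope.

(* qpow q a b = q^(a/b), the positive real b-th root of q^a, in algC *)
Definition qpow (q a b : nat) : algC := b.-root ((q ^ a)%N%:R).

Definition nsol (F : finFieldType) (n e : nat) : nat :=
  #|[set x : 'rV[F]_n | \sum_(i < n) x ord0 i ^+ e == 0]|.

(* Main.v *)
(** Summing over an additive character [psi], the number of solutions is
    [q^(n-1) + (q-1) / (2^m q) * sum_j eta_j^n], where the periods [eta_j] are
    combinations of the Gauss sums [G_r] of characters of order [2^r], [r <= m].
    Since [p = 3 mod 8], Frobenius makes the Gauss sum of [chi^c] depend only on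
    whether [c] is [1, 3] or [5, 7] modulo 8, so [G_r] lies in [Q(sqrt -2)] for
    [r < m] and in [sqrt(-p) Q(sqrt -2)] for [r = m], where [chi] restricts to the
    quadratic character of the prime field. The Hasse-Davenport relation for 2
    reads [G_r^2 = G_1 G_(r-1)] for [r >= 4], while [G_3^2 = G_1 J] for the Jacobi
    sum [J = J(chi_8, chi_8^3)] in [Z[sqrt -2]], whose rational part is prime to
    [p] because it is a carry-free binomial coefficient modulo [p]. Comparing
    powers of [p] along this tower yields [s = 2^(m-2) d] with [d] odd and
    [G_m = sqrt(-p) p^k (a + b sqrt -2)], [a^2 + 2 b^2 = p^d]. Squaring down the
    tower gives every [G_r], and uniqueness of the representation by
    [x^2 + 2 y^2], together with a congruence modulo 4, identifies the
    coefficients with [A_r] and [B_r]. *)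
Require Import Defs.
From HB Require Import structures.
From mathcomp Require Import all_boot all_order all_algebra.
From mathcomp Require Import all_solvable all_field.
From mathcomp Require Import algC zify ring.
Import Order.TTheory GRing.Theory Num.Theory.
Local Open Scope ring_scope.
Set Implicit Arguments. Unset Strict Implicit. Unset Printing Implicit Defensive.

(** * Characters and Gauss sums over a finite field *)

(** All information modulo [p] passes through rational integers: the trace of the Jacobi sum from
    the eighth cyclotomic field to the rationals is an integer, and the same character sum can be
    evaluated inside [F], where an eighth root of unity is a power of [g] and the sum becomes a
    binomial coefficient. What remains is a matter of signs. The sign of the quadratic Gauss sum
    comes from a congruence modulo 4 for the sum of psi(x^4), in which every nonzero fourth power is
    counted four times; this needs the shape of [s], hence comes after the comparison of powers of
    [p]. The signs of the B_r, and at the top order also those of A_m and of the square root of -p,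
    are never determined: they depend on the chosen roots of unity, and the periods in which they
    occur come in pairs c + d, c - d, so that only d^2 matters. That 2^m is the exact power of 2 in
    q - 1 is used to get chi(-1) = -1, which makes the restriction of chi to the prime field
    nontrivial. *)

Lemma unity_mul_conj (x : algC) k : (0 < k)%N -> x ^+ k = 1 -> x * x^* = 1.
Proof.
move=> k0 xk; rewrite -normCK; suff -> : `|x| = 1 by rewrite expr1n.
by apply/eqP; rewrite -(pexpr_eq1 k0) // -normrX xk normr1.
Qed.

Lemma expf_card_pred (F : finFieldType) (x : F) : x != 0 -> x ^+ #|F|.-1 = 1.
Proof.
move=> x0; have := expf_card x.
rewrite -{1}(prednK (ltnW (card_finNzRing_gt1 F))) exprS => E.
by apply: (mulfI x0); rewrite E mulr1.
Qed.

Lemma card_pred_gt0 (F : finFieldType) : (0 < #|F|.-1)%N.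
Proof. by have := card_finNzRing_gt1 F; case: #|F| => [|[]]. Qed.

Section Characters.
Variable F : finFieldType.
Implicit Types (chi lam psi : F -> algC).

Definition mult_char chi :=
  [/\ chi 0 = 0, chi 1 = 1 & {morph chi : x y / x * y}].
(** The clause on [- x] encodes that the values have absolute value 1. *)
Definition add_char psi :=
  [/\ psi 0 = 1, {morph psi : x y / x + y >-> x * y} &
      forall x, psi (- x) = (psi x)^*].
Definition nontriv_mult chi := exists2 x, x != 0 & chi x != 1.
Definition nontriv_add psi := exists x, psi x != 1.
Definition gauss psi chi := \sum_x chi x * psi x.
Definition jacobi chi lam := \sum_x chi x * lam (1 - x).

Lemma sum_mul_shift (V : nmodType) (f : F -> V) y : y != 0 ->
  \sum_x f (y * x) = \sum_x f x.
Proof. by move=> y0; rewrite [RHS](reindex_inj (mulfI y0)). Qed.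

Lemma mult_char_unity chi x : mult_char chi -> x != 0 ->
  chi x ^+ #|F|.-1 = 1.
Proof.
case=> _ c1 cM x0.
have cX k : chi (x ^+ k) = chi x ^+ k.
  by elim: k => [|k IH]; rewrite ?expr0 // !exprS cM IH.
by rewrite -cX expf_card_pred.
Qed.

Lemma mult_char_conj chi x : mult_char chi -> x != 0 -> chi x * (chi x)^* = 1.
Proof.
move=> mc x0.
exact: unity_mul_conj (card_pred_gt0 F) (mult_char_unity mc x0).
Qed.

Lemma mult_char_neq0 chi x : mult_char chi -> x != 0 -> chi x != 0.
Proof.
move=> mc x0; apply/eqP=> E; have := mult_char_conj mc x0.
by rewrite E mul0r => /eqP; rewrite eq_sym oner_eq0.
Qed.

Lemma mult_charX chi k : (0 < k)%N -> mult_char chi ->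
  mult_char (fun x => chi x ^+ k).
Proof.
move=> k0 [c0 c1 cM]; split=> [||x y]; rewrite ?c0 ?c1 ?expr1n //.
  by rewrite expr0n; case: k k0.
by rewrite cM exprMn.
Qed.

Lemma sum_mult_char chi : mult_char chi -> nontriv_mult chi ->
  \sum_x chi x = 0.
Proof.
move=> [c0 c1 cM] [y y0 cy]; apply/eqP.
have E : \sum_x chi x = chi y * \sum_x chi x.
  rewrite -[LHS](sum_mul_shift _ y0) mulr_sumr.
  by apply: eq_bigr => x _; rewrite cM.
have /eqP : (1 - chi y) * \sum_x chi x = 0 by rewrite mulrBl mul1r -E subrr.
by rewrite mulf_eq0 subr_eq0 eq_sym (negPf cy).
Qed.

Lemma sum_add_char psi y : add_char psi -> nontriv_add psi ->
  \sum_x psi (x * y) = if y == 0 then #|F|%:R else 0.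
Proof.
move=> [p0 pD _] [z nz]; have [->|y0] := eqVneq.
  under eq_bigr do rewrite mulr0 p0.
  by rewrite sumr_const cardT.
under eq_bigr do rewrite mulrC; rewrite (sum_mul_shift psi y0).
have E : \sum_x psi x = psi z * \sum_x psi x.
  rewrite [LHS](reindex_inj (addrI z)) mulr_sumr.
  by apply: eq_bigr => x _; rewrite pD.
have /eqP : (1 - psi z) * \sum_x psi x = 0 by rewrite mulrBl mul1r -E subrr.
by rewrite mulf_eq0 subr_eq0 eq_sym (negPf nz) => /eqP.
Qed.

Lemma gauss_twist psi chi y : mult_char chi -> y != 0 ->
  \sum_x chi x * psi (y * x) = (chi y)^* * gauss psi chi.
Proof.
move=> mc y0; rewrite /gauss -(sum_mul_shift (fun x => chi x * psi x) y0).
rewrite mulr_sumr; apply: eq_bigr => x _; case: (mc) => _ _ ->.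
rewrite !mulrA; congr (_ * _).
by rewrite [_^* * _]mulrC mult_char_conj // mul1r.
Qed.

(** The conjugate of [chi y] times the Gauss sum is the sum twisted by [y], so the product becomes a
    double sum of [chi x * psi (y * (x - 1))]; orthogonality in [y] leaves only [x = 1]. *)
Lemma gauss_norm psi chi : add_char psi -> nontriv_add psi -> mult_char chi ->
  nontriv_mult chi -> gauss psi chi * (gauss psi chi)^* = #|F|%:R.
Proof.
move=> ap np mc nc; have [c0 c1 cM] := mc; have [p0 pD pN] := ap.
have -> : gauss psi chi * (gauss psi chi)^* =
   \sum_y psi (- y) * ((chi y)^* * gauss psi chi).
  rewrite {2}/gauss rmorph_sum mulr_sumr; apply: eq_bigr => y _.
  by rewrite rmorphM pN; ring.
transitivity (\sum_y \sum_x chi x * psi (y * (x - 1))).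
  transitivity (\sum_(y | y != 0) \sum_x chi x * psi (y * (x - 1))).
    rewrite (bigD1 0) //= c0 rmorph0 mul0r mulr0 add0r; apply: eq_bigr => y y0.
    rewrite -(gauss_twist _ mc y0) mulr_sumr; apply: eq_bigr => x _.
    by rewrite mulrBr mulr1 pD; ring.
  (* The term [y = 0] can be added because the values of [chi] sum to 0. *)
  rewrite [RHS](bigD1 0) //=.
  under [X in _ = X + _]eq_bigr do rewrite mul0r p0 mulr1.
  by rewrite sum_mult_char // add0r.
rewrite exchange_big /= (bigD1 1) //= -mulr_sumr subrr sum_add_char // eqxx c1.
rewrite mul1r big1 ?addr0 // => x x1.
by rewrite -mulr_sumr sum_add_char // subr_eq0 (negPf x1) mulr0.
Qed.

Lemma gauss_conj psi chi : add_char psi -> mult_char chi ->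
  (gauss psi chi)^* = chi (- 1) * gauss psi (fun x => (chi x)^*).
Proof.
move=> [_ _ pN] mc; case: (mc) => _ c1 cM.
have nz : - 1 != 0 :> F by rewrite oppr_eq0 oner_eq0.
have E : chi (-1) * chi (-1) = 1 by rewrite -cM mulrNN mulr1.
have cN : (chi (-1))^* = chi (-1).
  by apply: (mulfI (mult_char_neq0 mc nz)); rewrite mult_char_conj // E.
rewrite /gauss rmorph_sum -[LHS](sum_mul_shift _ nz) mulr_sumr.
apply: eq_bigr => x _.
by rewrite cM !rmorphM /= cN mulN1r -pN opprK mulrA.
Qed.

(** Collect the pairs (x, y) by t = x + y. For nonzero t, rescaling x by t extracts the Jacobi sum;
    for t = 0 the inner sum is a multiple of the sum of [chi * lam], which vanishes. *)
Lemma gauss_jacobi psi chi lam : add_char psi -> mult_char chi ->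
  mult_char lam -> nontriv_mult (fun x => chi x * lam x) ->
  gauss psi chi * gauss psi lam =
  jacobi chi lam * gauss psi (fun x => chi x * lam x).
Proof.
move=> [_ pD _] [c0 c1 cM] [l0 l1 lM] nt.
have mcl : mult_char (fun x => chi x * lam x).
  by split=> [||x y]; rewrite ?c0 ?l0 ?c1 ?l1 ?mulr0 ?mulr1 // cM lM mulrACA.
transitivity (\sum_t (\sum_x chi x * lam (t - x)) * psi t).
  under [RHS]eq_bigr do rewrite mulr_suml.
  rewrite exchange_big /= /gauss mulr_suml; apply: eq_bigr => x _.
  rewrite mulr_sumr [RHS](reindex_inj (addIr x)) /=; apply: eq_bigr => y _.
  by rewrite addrK pD; ring.
rewrite mulr_sumr; apply: eq_bigr => t _; rewrite mulrA; congr (_ * _).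
have [->|t0] := eqVneq t 0.
  rewrite c0 mul0r mulr0.
  transitivity (lam (-1) * \sum_x chi x * lam x); last first.
    by rewrite (sum_mult_char mcl nt) mulr0.
  rewrite mulr_sumr; apply: eq_bigr => x _.
  by rewrite sub0r -[- x]mulN1r lM; ring.
rewrite -[LHS](sum_mul_shift _ t0) /jacobi mulr_suml; apply: eq_bigr => x _.
have -> : t - t * x = t * (1 - x) by rewrite mulrBr mulr1.
by rewrite cM lM; ring.
Qed.

(* x (1 - x) = (1 - y^2) / 4 for x = (1 - y) / 2 *)
Lemma jacobi_diag chi phi : 2 != 0 :> F -> mult_char chi ->
    nontriv_mult chi ->
    (forall d, #|[set x | x ^+ 2 == d]|%:R = 1 + phi d) ->
  chi 4 * jacobi chi chi = jacobi chi phi.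
Proof.
move=> n2 mc nc Hphi; have [c0 c1 cM] := mc.
have n2' : - 2 != 0 :> F by rewrite oppr_eq0.
have E : chi 4 * jacobi chi chi = \sum_y chi (1 - y ^+ 2).
  have inj : injective (fun x : F => 1 - 2 * x).
    by move=> x y /addrI /oppr_inj /(mulfI n2).
  rewrite [RHS](reindex_inj inj) mulr_sumr; apply: eq_bigr => x _.
  by rewrite -!cM; congr chi; ring.
rewrite E (partition_big (fun y => y ^+ 2) predT) //=.
under eq_bigr => d _.
  under eq_bigr => y /eqP -> do [].
  rewrite sumr_const.
  have -> : #|[pred y | y ^+ 2 == d]| = #|[set x | x ^+ 2 == d]|.
    by rewrite cardsE.
  rewrite -[_ *+ _]mulr_natr Hphi mulrDr mulr1; over.
have inj1 : injective (fun x : F => 1 - x) by move=> x y /addrI /oppr_inj.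
have S0 : \sum_d chi (1 - d) = 0.
  by rewrite -[RHS](sum_mult_char mc nc) [RHS](reindex_inj inj1).
rewrite big_split /= S0 add0r.
rewrite /jacobi [RHS](reindex_inj inj1); apply: eq_bigr => x _.
by rewrite subKr.
Qed.

End Characters.

(** * Discrete logarithms and the characters they define *)

Lemma exists_generator (F : finFieldType) :
  {g : F | #|F|.-1.-primitive_root g}.
Proof.
pose rs := [seq x <- enum F | x != 0].
suff /hasP/sig2W [g _ Hg] : has (#|F|.-1).-primitive_root rs by exists g.
apply: has_prim_root.
- exact: card_pred_gt0.
- apply/allP => x; rewrite mem_filter => /andP [x0 _].
  by rewrite unity_rootE expf_card_pred.
- by rewrite filter_uniq // enum_uniq.
- have E : rs =i [set~ 0] by move=> x; rewrite mem_filter mem_enum !inE andbT.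
  have /card_uniqP <- : uniq rs by rewrite filter_uniq // enum_uniq.
  by rewrite (eq_card E) cardsC1.
Qed.

Lemma sum_geometric_unity (R : idomainType) (c : R) f : c ^+ f = 1 ->
  \sum_(k < f) c ^+ k = if c == 1 then f%:R else 0.
Proof.
move=> cf; have [->|c1] := eqVneq.
  under eq_bigr do rewrite expr1n.
  by rewrite sumr_const card_ord.
have /eqP := subrX1 c f; rewrite cf subrr eq_sym mulf_eq0 subr_eq0 (negPf c1).
by move=> /eqP.
Qed.

Lemma sum_cyclic_shift (V : nmodType) (f : nat -> V) e k :
  (forall j, f (j + e)%N = f j) ->
  \sum_(j < e) f (j + k)%N = \sum_(j < e) f j.
Proof.
move=> fe; case: e fe => [|e] fe; first by rewrite !big_ord0.
elim: k => [|k IH]; first by apply: eq_bigr => j _; rewrite addn0.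
rewrite -IH big_ord_recr [RHS]big_ord_recl /= addrC add0n addnS -addSn addnC fe.
by congr (_ + _); apply: eq_bigr => j _; rewrite /bump /= add1n addnS addSn.
Qed.

Section Index.
Variables (F : finFieldType) (g : F).
Hypothesis Hg : #|F|.-1.-primitive_root g.

(** The discrete logarithm to base [g]. Its value 0 at [x = 0] is a default, always masked by a test
    on [x] or by the range of summation. *)
Definition ind (x : F) : nat :=
  if [pick i : 'I_#|F|.-1 | g ^+ i == x] is Some i then i else 0%N.

Lemma indK x : x != 0 -> g ^+ ind x = x.
Proof.
move=> x0; rewrite /ind; case: pickP => [i /eqP //|].
by have [i ->] := prim_rootP Hg (expf_card_pred x0) => /(_ i); rewrite eqxx.
Qed.

Lemma gen_neq0 i : g ^+ i != 0.
Proof.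
rewrite expf_neq0 //; apply/eqP=> g0.
have /eqP := prim_expr_order Hg; rewrite g0 expr0n.
by have := card_pred_gt0 F; case: (_.-1) => //= n _; rewrite eq_sym oner_eq0.
Qed.

(** As a natural number [ind] is not additive; only its class modulo [#|F|.-1] is meaningful. This
    lemma replaces [ind x] by any known exponent of [g]. *)
Lemma expr_ind (R : nzRingType) (z : R) x i : z ^+ #|F|.-1 = 1 ->
  g ^+ i = x -> z ^+ ind x = z ^+ i.
Proof.
move=> z1 gi; have x0 : x != 0 by rewrite -gi gen_neq0.
have /eqP : g ^+ ind x == g ^+ i by rewrite indK // gi.
move/eqP; rewrite (eq_prim_root_expr Hg) => /eqP E.
by rewrite -(expr_mod _ z1) E expr_mod.
Qed.

Definition pow_char (z : algC) (x : F) : algC := if x == 0 then 0 else z ^+ ind x.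

Lemma mult_char_pow z : z ^+ #|F|.-1 = 1 -> mult_char (pow_char z).
Proof.
move=> z1; rewrite /pow_char; split; rewrite ?eqxx ?oner_eq0 //.
  by rewrite (@expr_ind _ _ _ 0 z1) // expr0.
move=> x y; rewrite mulf_eq0.
have [_|x0] := eqVneq x 0; first by rewrite mul0r.
have [_|y0] := eqVneq y 0; first by rewrite mulr0.
rewrite /= -exprD; apply: expr_ind => //.
by rewrite exprD !indK.
Qed.

Lemma pow_char_gen z i : z ^+ #|F|.-1 = 1 -> pow_char z (g ^+ i) = z ^+ i.
Proof. by move=> z1; rewrite /pow_char (negPf (gen_neq0 i)); apply: expr_ind. Qed.

(** Orthogonality of the characters of order dividing [f]. At [u = 0] the term [k = 0] is 0^0 = 1,
    which counts the single root 0. *)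
Lemma card_root_set f z u : (f %| #|F|.-1)%N -> f.-primitive_root z ->
  #|[set x | x ^+ f == u]|%:R = \sum_(k < f) pow_char z u ^+ k.
Proof.
move=> fq Hz; have f0 := prim_order_gt0 Hz.
have z1 : z ^+ #|F|.-1 = 1 by apply/eqP; rewrite -(prim_order_dvd Hz).
have [->|u0] := eqVneq u 0.
  have -> : [set x : F | x ^+ f == 0] = [set 0].
    by apply/setP=> x; rewrite !inE expf_eq0 f0.
  rewrite cards1 /pow_char eqxx; case: f f0 {fq Hz} => // f _.
  rewrite big_ord_recl expr0 big1 ?addr0 // => i _.
  by rewrite expr0n.
rewrite sum_geometric_unity; last first.
  by rewrite /pow_char (negPf u0) exprAC (prim_expr_order Hz) expr1n.
rewrite /pow_char (negPf u0) -(prim_order_dvd Hz).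
case: ifP => [/dvdnP [k Ek]|nd].
  (* The roots form the coset of [g ^+ k] modulo the [f]-th roots of unity. *)
  have Hw := dvdn_prim_root Hg fq; set w := g ^+ _ in Hw.
  pose h (i : 'I_f) := g ^+ k * w ^+ i.
  have injh : injective h.
    move=> i j /(mulfI (gen_neq0 k)) /eqP; rewrite (eq_prim_root_expr Hw).
    by rewrite !modn_small // => /eqP /val_inj.
  have Eu : (g ^+ k) ^+ f = u by rewrite -exprM -Ek indK.
  suff -> : [set x | x ^+ f == u] = h @: 'I_f by rewrite card_imset // card_ord.
  apply/setP => x; rewrite !inE; apply/eqP/imsetP => [xf|[i _ ->]]; last first.
    by rewrite /h exprMn Eu exprAC (prim_expr_order Hw) expr1n mulr1.
  have [|i Ei] := @prim_rootP _ _ _ Hw (x / g ^+ k).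
    by rewrite exprMn exprVn xf Eu divff.
  by exists i => //; rewrite /h -Ei mulrC divfK // gen_neq0.
suff -> : [set x | x ^+ f == u] = set0 by rewrite cards0.
apply/setP => x; rewrite !inE; apply/eqP => xf; case/negP: (negbT nd).
have x0 : x != 0 by apply: contraNneq u0 => x0; rewrite -xf x0 expr0n eqn0Ngt f0.
rewrite (prim_order_dvd Hz) (@expr_ind _ _ _ (ind x * f) z1).
  by rewrite mulnC exprM (prim_expr_order Hz) expr1n.
by rewrite exprM indK.
Qed.

(** Multiplying [y] by [g ^+ j] shifts its index by [j]. Averaging over [j < e] turns each term into
    a full cyclic sum, so no residue class of indices has to be counted. *)
Lemma sum_index (w : algC) e (h : algC -> algC) : w ^+ e = 1 ->
  (e %| #|F|.-1)%N ->
  e%:R * \sum_(y | y != 0) h (w ^+ ind y) = #|F|.-1%:R * \sum_(j < e) h (w ^+ j).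
Proof.
move=> we eq.
have w1 : w ^+ #|F|.-1 = 1 by rewrite -(divnK eq) mulnC exprM we expr1n.
have shift j : \sum_(y | y != 0) h (w ^+ ind y) =
    \sum_(y | y != 0) h (w ^+ (j + ind y)).
  rewrite (reindex_inj (mulfI (gen_neq0 j))) /=.
  apply: eq_big => y; first by rewrite mulf_eq0 (negPf (gen_neq0 j)).
  rewrite mulf_eq0 (negPf (gen_neq0 j)) /= => y0; congr h.
  by apply: expr_ind => //; rewrite exprD indK.
transitivity (\sum_(j < e) \sum_(y : F | y != 0) h (w ^+ (j + ind y))).
  under [RHS]eq_bigr do rewrite -shift.
  by rewrite sumr_const card_ord mulr_natl.
rewrite exchange_big /=.
under eq_bigr => y _.
  rewrite (@sum_cyclic_shift _ (fun j => h (w ^+ j))); last first.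
    by move=> j; rewrite exprD we mulr1.
  over.
rewrite sumr_const mulr_natl; congr (_ *+ _).
by rewrite -(cardsC1 (0 : F)); apply: eq_card => x; rewrite !inE.
Qed.

End Index.

(** * The trace to the prime field *)

Section Trace.
Variables (F : finFieldType) (p s : nat).
Hypotheses (p_pr : prime p) (cardF : #|F| = (p ^ s)%N) (s_gt0 : (0 < s)%N).

Let charF : p \in [pchar F] := card_finPcharP cardF p_pr.

Definition iota_Fp (c : 'F_p) : F := (val c)%:R.

Lemma iota_natr k : iota_Fp k%:R = k%:R.
Proof. by rewrite /iota_Fp /= val_Fp_nat // (GRing.natr_mod_pchar charF). Qed.

Lemma iota_FpD : {morph iota_Fp : c d / c + d}.
Proof.
by move=> c d; rewrite -[c]natr_Zp -[d]natr_Zp -natrD !iota_natr natrD.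
Qed.

Lemma iota_FpM : {morph iota_Fp : c d / c * d}.
Proof.
by move=> c d; rewrite -[c]natr_Zp -[d]natr_Zp -natrM !iota_natr natrM.
Qed.

Lemma iota_Fp1 : iota_Fp 1 = 1.
Proof. exact: (iota_natr 1). Qed.

Lemma iota_Fp0 : iota_Fp 0 = 0.
Proof. exact: (iota_natr 0). Qed.

Lemma iota_Fp_eq0 c : (iota_Fp c == 0) = (c == 0).
Proof.
apply/idP/eqP => [|->]; last by rewrite iota_Fp0.
rewrite /iota_Fp -(dvdn_pcharf charF) => d; rewrite -[c]natr_Zp.
by apply/eqP; rewrite -(dvdn_pcharf (pchar_Fp p_pr)).
Qed.

Lemma iota_Fp_inj : injective iota_Fp.
Proof.
move=> c d E; apply/eqP; rewrite -subr_eq0 -iota_Fp_eq0.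
have := iota_FpD (c - d) d; rewrite subrK E => /eqP.
by rewrite -subr_eq subrr eq_sym.
Qed.

Lemma iota_FpX c i : iota_Fp c ^+ (p ^ i) = iota_Fp c.
Proof.
have Ep : iota_Fp c ^+ p = iota_Fp c.
  by rewrite -(pFrobenius_autE charF) /iota_Fp pFrobenius_aut_nat.
by elim: i => [|i IH]; rewrite ?expr1 // expnS exprM Ep IH.
Qed.

(** X^p - X has at most [p] roots, and the image of the prime field already supplies [p] of them. *)
Lemma prime_subfield (y : F) : y ^+ p = y -> exists c, y = iota_Fp c.
Proof.
move=> yp; pose P : {poly F} := 'X^p - 'X.
have p1 := prime_gt1 p_pr.
have sP : size P = p.+1 by rewrite /P size_polyDl ?size_polyXn // size_polyN size_polyX.
have P0 : P != 0 by rewrite -size_poly_eq0 sP.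
have [/mapP [c _ ->]|ny] := boolP (y \in [seq iota_Fp c | c in 'F_p]).
  by exists c.
have := @max_poly_roots _ P (y :: [seq iota_Fp c | c in 'F_p]) P0.
rewrite /= ny map_inj_uniq ?enum_uniq; last exact: iota_Fp_inj.
rewrite size_map -cardE card_Fp // sP ltnn => /(_ _ isT) H; case: (notF _).
apply: H; rewrite /root /P !hornerE yp subrr eqxx /=.
apply/allP => _ /mapP [c _ ->]; rewrite /root !hornerE.
by rewrite -[p in _ ^+ p]expn1 iota_FpX subrr.
Qed.

Definition trF (x : F) : F := \sum_(i < s) x ^+ (p ^ i).

(** Frobenius permutes the summands of the trace cyclically, since x^(p^s) = x. *)
Lemma trF_shift x : \sum_(i < s) x ^+ (p ^ i.+1) = trF x.
Proof.
rewrite /trF -[RHS](@sum_cyclic_shift _ (fun i => x ^+ (p ^ i)%N) s 1).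
  by apply: eq_bigr => i _; rewrite addn1.
by move=> j; rewrite expnD mulnC exprM -cardF expf_card.
Qed.

Lemma trFD : {morph trF : x y / x + y}.
Proof.
move=> x y; rewrite /trF -big_split; apply: eq_bigr => i _ /=.
by rewrite exprDn_pchar // pnatX pnatE // charF.
Qed.

Lemma trF_frob x : trF (x ^+ p) = trF x.
Proof.
by rewrite -[RHS]trF_shift; apply: eq_bigr => i _; rewrite -exprM expnS.
Qed.

Lemma trF_pow x : trF x ^+ p = trF x.
Proof.
rewrite -(pFrobenius_autE charF) /trF rmorph_sum /= -[RHS]trF_shift.
by apply: eq_bigr => i _; rewrite pFrobenius_autE -exprM expnSr.
Qed.

Lemma trF_scale c x : trF (iota_Fp c * x) = iota_Fp c * trF x.
Proof.
by rewrite /trF mulr_sumr; apply: eq_bigr => i _; rewrite exprMn iota_FpX.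
Qed.

(** As a polynomial the trace has degree p^(s-1), too small to vanish on all of [F]. *)
Lemma trF_neq0 : exists x, trF x != 0.
Proof.
pose P : {poly F} := \sum_(i < s) 'X^(p ^ i).
have p1 := prime_gt1 p_pr.
have sP : size P = (p ^ s.-1).+1.
  rewrite /P; case: s s_gt0 => // t _; rewrite big_ord_recr /=.
  rewrite addrC size_polyDl ?size_polyXn //.
  apply: (leq_ltn_trans (size_sum _ _ _)); rewrite ltnS.
  by apply/bigmax_leqP => i _; rewrite size_polyXn ltn_exp2l.
have P0 : P != 0 by rewrite -size_poly_eq0 sP.
have [x Hx|H] := pickP [pred x | trF x != 0]; first by exists x.
have rt : all (root P) (enum F).
  apply/allP => x _; rewrite /root /P horner_sum.
  by under eq_bigr do rewrite hornerXn; have /negbFE := H x.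
have := max_poly_roots P0 rt (enum_uniq F).
by rewrite -cardE cardF sP ltnS leq_exp2l // leqNgt prednK // leqnn.
Qed.

Definition trFp (x : F) : 'F_p := odflt 0 [pick c | iota_Fp c == trF x].

Lemma trFpK x : iota_Fp (trFp x) = trF x.
Proof.
rewrite /trFp; case: pickP => [c /eqP //|].
by have [c ->] := prime_subfield (trF_pow x) => /(_ c); rewrite eqxx.
Qed.

Lemma trFpD : {morph trFp : x y / x + y}.
Proof. by move=> x y; apply: iota_Fp_inj; rewrite iota_FpD !trFpK trFD. Qed.

Lemma trFp_frob x : trFp (x ^+ p) = trFp x.
Proof. by apply: iota_Fp_inj; rewrite !trFpK trF_frob. Qed.

Lemma trFp_scale c x : trFp (iota_Fp c * x) = c * trFp x.
Proof. by apply: iota_Fp_inj; rewrite iota_FpM !trFpK trF_scale. Qed.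

Variable zp : algC.
Hypothesis Hzp : p.-primitive_root zp.

Definition psi0 (c : 'F_p) : algC := zp ^+ c.

Lemma psi0_natr k : psi0 k%:R = zp ^+ k.
Proof. by rewrite /psi0 val_Fp_nat // prim_expr_mod. Qed.

Lemma add_char_psi0 : add_char psi0.
Proof.
have D : {morph psi0 : x y / x + y >-> x * y}.
  by move=> c d; rewrite -[c]natr_Zp -[d]natr_Zp -natrD !psi0_natr exprD.
have p0 : psi0 0 = 1 by rewrite (psi0_natr 0).
split=> // c; have E := D c (- c); rewrite subrr p0 in E.
have n0 : psi0 c != 0.
  by apply/eqP=> Z; move/eqP: E; rewrite Z mul0r oner_eq0.
apply: (mulfI n0); rewrite -E; apply/esym.
apply: (unity_mul_conj (prime_gt0 p_pr)).
by rewrite /psi0 exprAC (prim_expr_order Hzp) expr1n.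
Qed.

Lemma psi0_eq1 c : (psi0 c == 1) = (c == 0).
Proof.
rewrite /psi0 -(prim_order_dvd Hzp) (dvdn_pcharf (pchar_Fp p_pr)).
by rewrite natr_Zp.
Qed.

Lemma nontriv_psi0 : nontriv_add psi0.
Proof. by exists 1; rewrite psi0_eq1 oner_eq0. Qed.

Definition psiF x := psi0 (trFp x).

Lemma add_char_psiF : add_char psiF.
Proof.
have [p0 pD pN] := add_char_psi0.
have t0 : trFp 0 = 0.
  by have /eqP := trFpD 0 0; rewrite addr0 -subr_eq0 opprD addNKr oppr_eq0 => /eqP.
rewrite /psiF; split=> [|x y|x]; first by rewrite t0.
  by rewrite trFpD pD.
rewrite -pN; congr psi0; apply/eqP.
by rewrite -addr_eq0 -trFpD addNr t0.
Qed.

Lemma nontriv_psiF : nontriv_add psiF.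
Proof.
have [x Hx] := trF_neq0; exists x.
by rewrite psi0_eq1 -iota_Fp_eq0 trFpK.
Qed.

Lemma psiF_frob x : psiF (x ^+ p) = psiF x.
Proof. by rewrite /psiF trFp_frob. Qed.

Lemma psiF_Aint x : psiF x \in Aint.
Proof. by rewrite rpredX // (Aint_prim_root Hzp). Qed.

End Trace.

(** * Arithmetic *)

Lemma dvdz_primeM (p : nat) (m n : int) : prime p ->
  (p%:Z %| m * n)%Z = (p%:Z %| m)%Z || (p%:Z %| n)%Z.
Proof. by move=> pr; rewrite !dvdzE abszM Euclid_dvdM. Qed.

Lemma dvdz_primeX2 (p : nat) (m : int) : prime p ->
  (p%:Z %| m ^+ 2)%Z = (p%:Z %| m)%Z.
Proof. by move=> pr; rewrite expr2 dvdz_primeM // orbb. Qed.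

Lemma prime_ndvdz2 (p : nat) : prime p -> odd p -> ~~ (p%:Z %| 2)%Z.
Proof.
move=> pr od; rewrite dvdzE /= gtnNdvd //.
by case: p od pr => [|[|[|]]].
Qed.

(** The oddness of the cofactor is the point: multiplying an odd number by this power of [p] changes
    it by exactly 2^r modulo 2^(r+1), which is how [pow_mod_two_step] corrects one binary digit. *)
Lemma pow_two_expansion p r : (p %% 8 = 3)%N -> (3 <= r)%N ->
  exists u, (p ^ (2 ^ (r - 2)) = 1 + 2 ^ r * u.*2.+1)%N.
Proof.
move=> p3; elim: r => // r IH; rewrite leq_eqVlt => /predU1P [[<-]|lr].
  exists (4 * (p %/ 8) ^ 2 + 3 * (p %/ 8))%N; rewrite {1}(divn_eq p 8) p3.
  by rewrite -!mulnn -muln2 !expnS expn0; nia.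
have [u Hu] := IH lr; exists (u + 2 ^ (r - 2) * u.*2.+1 ^ 2)%N.
rewrite subSn ?expnS; last lia.
rewrite mulnC expnM Hu.
have -> : (2 ^ r = 4 * 2 ^ (r - 2))%N by rewrite -(expnD 2 2); congr expn; lia.
by rewrite -!mulnn -!muln2 ; nia.
Qed.

(** A congruence modulo 2^r either lifts to 2^(r+1) or fails by 2^r, and then the factor
    [1 + 2 ^ r * w] repairs it. Congruences are written with two natural multipliers to avoid
    subtraction. *)
Lemma pow_mod_two_step (p r k c w : nat) : odd p -> odd w ->
  (exists a b, p ^ k + 2 ^ r * a = c + 2 ^ r * b)%N ->
  (exists a b, p ^ k + 2 ^ r.+1 * a = c + 2 ^ r.+1 * b)%N \/
  (exists a b, p ^ k * (1 + 2 ^ r * w) + 2 ^ r.+1 * a = c + 2 ^ r.+1 * b)%N.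
Proof.
move=> op ow [a [b E]].
have half x y : odd x = odd y -> exists a' b' e, (x = a' * 2 + e /\ y = b' * 2 + e)%N.
  move=> O; exists x./2, y./2, (odd x : nat).
  by split; rewrite muln2 addnC; [|rewrite O]; rewrite odd_double_half.
have [O|O] := eqVneq (odd a) (odd b).
  have [a' [b' [e [Ea Eb]]]] := half _ _ O; left; exists a', b'.
  by move: E; rewrite Ea Eb expnS; lia.
have O2 : odd a = odd (b + w * p ^ k).
  rewrite oddD oddM ow oddX op orbT /=.
  by case: (odd a) (odd b) O => [] [].
have [a' [b' [e [Ea Eb]]]] := half _ _ O2; right; exists a', b'.
have E2 : (p ^ k * (1 + 2 ^ r * w) + 2 ^ r * a = c + 2 ^ r * (b + w * p ^ k))%N.
  by lia.
by move: E2; rewrite Ea Eb expnS; lia.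
Qed.

(** The powers of [p] fill the classes 1 and 3 modulo 8 in the unit group modulo 2^r. Digits are
    corrected one at a time, starting from p^0 and p^1 modulo 8. *)
Lemma pow_mod_two p r c : (p %% 8 = 3)%N -> (3 <= r)%N ->
  (c %% 8 = 1)%N \/ (c %% 8 = 3)%N -> exists k, (p ^ k = c %[mod 2 ^ r])%N.
Proof.
move=> p3 lr Hc.
suff : exists k a b, (p ^ k + 2 ^ r * a = c + 2 ^ r * b)%N.
  move=> [k [a [b E]]]; exists k.
  have : (p ^ k + 2 ^ r * a = c + 2 ^ r * b %[mod 2 ^ r])%N by rewrite E.
  by rewrite !(mulnC (2 ^ r)%N) ![(_ + _ * _)%N]addnC !modnMDl.
have op : odd p by lia.
elim: r lr => // r IH; rewrite leq_eqVlt => /predU1P [[<-]|lr].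
  case: Hc => Hc; [exists 0%N, (c %/ 8)%N, 0%N | exists 1%N, (c %/ 8)%N, (p %/ 8)%N].
    by rewrite {2}(divn_eq c 8) Hc expn0; lia.
  by rewrite {2}(divn_eq c 8) Hc {1}(divn_eq p 8) p3 expn1; lia.
have [k H] := IH lr; have [u Hu] := pow_two_expansion p3 lr.
have [|H1|H1] := @pow_mod_two_step p r k c u.*2.+1 op _ H.
- by rewrite /= odd_double.
- by exists k.
by exists (k + 2 ^ (r - 2))%N; rewrite expnD Hu.
Qed.

Lemma divn_eqP (a u v P : nat) : (v < P)%N -> a = (u * P + v)%N -> (a %/ P)%N = u.
Proof.
by move=> vP ->; rewrite divnMDl ?divn_small ?addn0 //; apply: leq_trans vP.
Qed.

(* With 8 k = p^s - 1, the sum 3 k + 4 k has no carry in base p. *)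
Lemma binomial_ndvd p s k : prime p -> (p %% 8 = 3)%N -> (8 * k).+1 = (p ^ s)%N ->
  ~~ (p %| 'C(7 * k, 3 * k))%N.
Proof.
move=> pr p3 Hk.
have p1 := prime_gt1 pr.
have le : (3 * k <= 7 * k)%N by lia.
have bp : (0 < 'C(7 * k, 3 * k))%N by rewrite bin_gt0.
rewrite -[p in (p %| _)%N]expn1 pfactor_dvdn // -eqn0Ngt.
have E := bin_fact le; rewrite (_ : (7 * k - 3 * k = 4 * k)%N) in E; last lia.
have /eqP := congr1 (logn p) E.
rewrite !lognM ?muln_gt0 ?fact_gt0 // !logn_fact //.
(* The Legendre formula gives three sums with different bounds; the terms beyond [n] are zero, so
   all can be extended to [7 * k]. *)
have ext n : (n <= 7 * k)%N ->
    (\sum_(1 <= j < n.+1) n %/ p ^ j = \sum_(1 <= j < (7 * k).+1) n %/ p ^ j)%N.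
  move=> ln; rewrite [RHS](big_cat_nat (n := n.+1)) //=.
  rewrite [X in (_ = _ + X)%N]big1_seq ?addn0 // => j /andP [_].
  rewrite mem_index_iota => /andP [nj _]; apply: divn_small.
  by apply: (leq_trans _ (ltnW (ltn_expl j p1))); lia.
rewrite ext; last lia.
rewrite [X in (_ + (_ + X) == _)%N]ext; last lia.
have Pmod j : (p ^ j %% 8 = 1)%N \/ (p ^ j %% 8 = 3)%N.
  elim: j => [|j IH]; first by left.
  by rewrite expnS -modnMml p3 -modnMmr; case: IH => ->; [right|left].
rewrite -big_split /= -[X in (_ + _ == X)%N]add0n.
rewrite [X in (_ + X == _)%N](_ : _ = (\sum_(1 <= j < (7 * k).+1) 7 * k %/ p ^ j)%N).
  by rewrite eqn_add2r.
apply: eq_bigr => j _.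
have [js|js] := leqP j s; last first.
  have L : (p ^ s < p ^ j)%N by rewrite ltn_exp2l.
  by rewrite !divn_small //; lia.
have EP : (p ^ (s - j) * p ^ j = (8 * k).+1)%N by rewrite -expnD subnK.
have := Pmod j; have := Pmod (s - j)%N; move: EP.
set P := (p ^ j)%N; set M := (p ^ (s - j))%N => EP HM HP.
have P8 := divn_eq P 8; have M8 := divn_eq M 8.
set t := (P %/ 8)%N in P8; set mu := (M %/ 8)%N in M8.
have key (a b : nat) : P = (t * 8 + a)%N -> M = (mu * 8 + b)%N ->
  (64 * (mu * t) + 8 * (a * mu) + 8 * (b * t) + a * b = (8 * k).+1)%N.
  by move=> EPa EMb; rewrite -EP EPa EMb; lia.
clearbody P M t mu; rewrite {Pmod ext E Hk}.
have Ek (a b : nat) : P = (t * 8 + a)%N -> (mu * P = 8 * (mu * t) + a * mu)%N.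
  by move=> ->; lia.
(* As [M * P] is 1 modulo 8, the two residues agree. In both remaining cases the quotients of
   [3 * k] and [4 * k] by [P] add up to that of [7 * k]: there is no carry. *)
case: HP => HP; case: HM => HM; rewrite HP in P8; rewrite HM in M8;
  have K := key _ _ P8 M8; have K2 := Ek _ 0%N P8; try by exfalso; lia.
- rewrite (@divn_eqP (7 * k) (7 * mu) (7 * t) P) //; try lia.
  rewrite (@divn_eqP (3 * k) (3 * mu) (3 * t) P) //; try lia.
  by rewrite (@divn_eqP (4 * k) (4 * mu) (4 * t) P) //; lia.
- rewrite (@divn_eqP (7 * k) (7 * mu + 2) (5 * t + 1) P) //; try lia.
  rewrite (@divn_eqP (3 * k) (3 * mu + 1) t P) //; try lia.
  by rewrite (@divn_eqP (4 * k) (4 * mu + 1) (4 * t + 1) P) //; lia.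
Qed.

Lemma sum_blocks (V : nmodType) (f : nat -> V) n k :
  \sum_(i < n * k) f i = \sum_(a < n) \sum_(b < k) f (a * k + b)%N.
Proof.
elim: n f => [|n IH] f; first by rewrite !big_ord0.
rewrite mulSn big_split_ord big_ord_recl /=; congr (_ + _).
by rewrite (IH (fun i => f (k + i)%N)); apply: eq_bigr => a _;
   apply: eq_bigr => b _; rewrite /bump /= mulSn addnA.
Qed.

(** Sorting by 2-adic valuation. It serves twice: for the exponents of [chi], where the valuation
    gives the order of the character, and for the indices of the periods. *)
Lemma sum_dyadic (V : nmodType) (f : nat -> V) m :
  \sum_(j < 2 ^ m) f j =
  f 0%N + \sum_(t < m) \sum_(i < 2 ^ (m - t.+1)) f (2 ^ t * i.*2.+1)%N.
Proof.
elim: m f => [|m IH] f; first by rewrite big_ord_recl !big_ord0.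
rewrite expnS mulnC sum_blocks.
under eq_bigr => a _ do
  rewrite big_ord_recl big_ord1 addn0 /bump /= addn1.
rewrite big_split /= (IH (fun i => f (i * 2)%N)) mul0n -addrA; congr (_ + _).
rewrite big_ord_recl addrC /=; congr (_ + _).
  by rewrite subn1 /=; apply: eq_bigr => a _; rewrite mul1n muln2.
apply: eq_bigr => t _; apply: eq_bigr => i _.
congr f; have -> : (2 ^ bump 0 t = 2 * 2 ^ t)%N by rewrite /bump add1n expnS.
by rewrite mulnC mulnA.
Qed.

Lemma eq_sqr_pair (x y c : algC) n : x ^+ 2 = y ^+ 2 ->
  (c + x) ^+ n + (c - x) ^+ n = (c + y) ^+ n + (c - y) ^+ n.
Proof. by move/eqP; rewrite eqf_sqr => /orP [] /eqP -> //; rewrite opprK addrC. Qed.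

(** * Representations of powers of [p] by x^2 + 2 y^2 *)

Lemma Posz_expn (a k : nat) : (a ^ k)%N%:Z = a%:Z ^+ k.
Proof. by rewrite -!natz natrX. Qed.

(** With P = p^d one has P (A^2 - a^2) = 2 (Ab - aB)(Ab + aB). As [p] divides at most one of the
    last two factors, P divides the other. The composition identity P^2 = (Aa -+ 2Bb)^2 + 2 (Ab +-
    aB)^2 then forces that factor to be 0, for otherwise the right side would be at least 2 P^2. *)
Lemma sqr_form_unique (p d : nat) (A B a b : int) : prime p -> odd p ->
  (0 < d)%N -> A ^+ 2 + 2 * B ^+ 2 = (p ^ d)%N%:Z -> ~~ (p%:Z %| A)%Z ->
  a ^+ 2 + 2 * b ^+ 2 = (p ^ d)%N%:Z -> ~~ (p%:Z %| a)%Z ->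
  a ^+ 2 = A ^+ 2 /\ b ^+ 2 = B ^+ 2.
Proof.
move=> pr od d0 EA nA Ea na.
have n2 := prime_ndvdz2 pr od.
suff E : a ^+ 2 = A ^+ 2.
  split=> //; apply: (@mulfI _ (2 : int)) => //.
  by apply: (@addrI _ (A ^+ 2)); rewrite EA -E.
set P : int := (p ^ d)%N%:Z in EA Ea.
have P0 : 0 < P by rewrite ltz_nat expn_gt0 prime_gt0.
have pP : (p%:Z %| P)%Z by rewrite dvdzE /= -[p in (p %| _)%N]expn1 dvdn_exp2l.
have coP (x : int) : ~~ (p%:Z %| x)%Z -> coprimez P (2 * x).
  move=> nx; rewrite coprimezE (_ : `|P|%N = (p ^ d)%N) // coprimeXl //.
  rewrite prime_coprime // -[X in ~~ X]/(p%:Z %| 2 * x)%Z.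
  by rewrite dvdz_primeM // negb_or n2.
clearbody P.
have nb : ~~ (p%:Z %| b)%Z.
  apply/negP => pb; case/negP: na; rewrite -dvdz_primeX2 //.
  have -> : a ^+ 2 = P - 2 * b * b by rewrite -Ea; ring.
  by rewrite rpredB // dvdz_mull.
have small (u k : int) : u ^+ 2 + 2 * (P * k) ^+ 2 = P ^+ 2 -> k = 0.
  move=> E; apply/eqP; apply: contraTT isT => k0.
  have k1 : 1 <= k ^+ 2 by move: k0; rewrite -sqrf_eq0; have := sqr_ge0 k; lia.
  have u0 := sqr_ge0 u; have PP : 0 < P ^+ 2 by rewrite exprn_gt0.
  have := ler_peMr (ltW PP) k1; rewrite exprMn in E.
  by move: E u0 PP; move: (P ^+ 2 * k ^+ 2) (P ^+ 2) (u ^+ 2) => x y z; clear; lia.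
have E2 : P * (A ^+ 2 - a ^+ 2) = 2 * (A * b - a * B) * (A * b + a * B).
  transitivity (A ^+ 2 * (a ^+ 2 + 2 * b ^+ 2) - a ^+ 2 * (A ^+ 2 + 2 * B ^+ 2)).
    by rewrite EA Ea; ring.
  by ring.
have D2 : (P %| 2 * (A * b - a * B) * (A * b + a * B))%Z by rewrite -E2 dvdz_mulr.
have fin (x : int) : x = 0 -> 2 * x * (A * b + a * B) = P * (A ^+ 2 - a ^+ 2) \/
     2 * (A * b - a * B) * x = P * (A ^+ 2 - a ^+ 2) -> a ^+ 2 = A ^+ 2.
  move=> -> H; apply/eqP; rewrite eq_sym -subr_eq0.
  have : P * (A ^+ 2 - a ^+ 2) == 0 by case: H => <-; rewrite !(mulr0, mul0r).
  by rewrite mulf_eq0 gt_eqF.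
have [px|nx] := boolP (p%:Z %| A * b - a * B)%Z; last first.
  have : (P %| A * b + a * B)%Z by rewrite -(Gauss_dvdzr _ (coP _ nx)).
  move=> /dvdzP [k Ek]; apply: (fin (A * b + a * B)); last by right; rewrite E2.
  rewrite Ek (small (A * a - 2 * B * b) k) ?mul0r // -[P * k]mulrC -Ek.
  rewrite (_ : P ^+ 2 = (A ^+ 2 + 2 * B ^+ 2) * (a ^+ 2 + 2 * b ^+ 2)); first ring.
by rewrite EA Ea expr2.
have ny : ~~ (p%:Z %| A * b + a * B)%Z.
  apply/negP => py; have := rpredD px py.
  have -> : A * b - a * B + (A * b + a * B) = 2 * (A * b) by ring.
  by rewrite !dvdz_primeM // (negPf n2) (negPf nA) (negPf nb).
have : (P %| A * b - a * B)%Z.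
  rewrite -(Gauss_dvdzr _ (coP _ ny)).
  by rewrite [X in (_ %| X)%Z](_ : _ = 2 * (A * b - a * B) * (A * b + a * B)) //; ring.
move=> /dvdzP [k Ek]; apply: (fin (A * b - a * B)); last by left; rewrite E2.
rewrite Ek (small (A * a + 2 * B * b) k) ?mul0r // -[P * k]mulrC -Ek.
rewrite (_ : P ^+ 2 = (A ^+ 2 + 2 * B ^+ 2) * (a ^+ 2 + 2 * b ^+ 2)); first ring.
by rewrite EA Ea expr2.
Qed.

(** Descent: if [p] divides [X] it divides [Y], and p^2 can be removed. The oddness of [N] keeps the
    exponent positive, since p^2 does not divide [p]. *)
Lemma sqr_form_primitive (p N : nat) (X Y : int) : prime p -> odd p ->
  X ^+ 2 + 2 * Y ^+ 2 = (p ^ N)%N%:Z -> odd N ->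
  exists c a b, [/\ X = p%:Z ^+ c * a, Y = p%:Z ^+ c * b, (2 * c < N)%N,
     a ^+ 2 + 2 * b ^+ 2 = (p ^ (N - 2 * c))%N%:Z & ~~ (p%:Z %| a)%Z].
Proof.
move=> pr od; elim/ltn_ind: N X Y => N IH X Y E oN.
have N0 : (0 < N)%N by case: N oN {IH E}.
have [pX|nX] := boolP (p%:Z %| X)%Z; last first.
  by exists 0%N, X, Y; rewrite !mul1r muln0 subn0.
have pY : (p%:Z %| Y)%Z.
  have : (p%:Z %| 2 * Y ^+ 2)%Z.
    have -> : 2 * Y ^+ 2 = (p ^ N)%N%:Z - X * X by rewrite -E; ring.
    by rewrite rpredB ?dvdz_mull // dvdzE /= -[p in (p %| _)%N]expn1 dvdn_exp2l.
  by rewrite dvdz_primeM // dvdz_primeX2 // (negPf (prime_ndvdz2 pr od)).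
case/dvdzP: pX => x EX; case/dvdzP: pY => y EY.
have p0 : (p%:Z ^+ 2 != 0) by rewrite expf_neq0 // -lt0n prime_gt0.
have N2 : (2 <= N)%N.
  rewrite ltnNge; apply/negP => N1; have N1' : N = 1%N by lia.
  have : (p%:Z ^+ 2 %| p%:Z)%Z.
    apply/dvdzP; exists (x ^+ 2 + 2 * y ^+ 2).
    rewrite N1' expn1 in E; apply: (etrans (esym E)); rewrite EX EY; ring.
  rewrite dvdzE abszX /= => /dvdn_leq; rewrite prime_gt0 // => /(_ isT).
  by have := prime_gt1 pr; rewrite -mulnn; nia.
have N2N : (N - 2 < N)%N by lia.
have oN2 : odd (N - 2) by rewrite oddB ?oN.
have Exy : x ^+ 2 + 2 * y ^+ 2 = (p ^ (N - 2))%N%:Z.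
  apply: (mulfI p0); have -> : p%:Z ^+ 2 * (p ^ (N - 2))%N%:Z = (p ^ N)%N%:Z.
    by rewrite -[in RHS](subnKC N2) expnD PoszM Posz_expn.
  by rewrite -E EX EY; ring.
have [c [a [b [Ex Ey lc Eab na]]]] := IH _ N2N x y Exy oN2.
have NE : (N - 2 - 2 * c = N - 2 * c.+1)%N by move: lc; clear; lia.
exists c.+1, a, b; split=> //.
- by rewrite EX Ex exprS; ring.
- by rewrite EY Ey exprS; ring.
- by move: lc; clear; lia.
- by rewrite Eab NE.
Qed.

(** * The field Q(sqrt -2) *)

Section QuadraticField.
Variable sg : algC.
Hypotheses (sg2 : sg ^+ 2 = - 2) (sgC : sg^* = - sg) (sgA : sg \in Aint).

Definition in_Qsg (z : algC) :=
  exists x y, [/\ x \in Crat, y \in Crat & z = x + y * sg].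

Lemma in_QsgD z w : in_Qsg z -> in_Qsg w -> in_Qsg (z + w).
Proof.
move=> [x [y [Qx Qy ->]]] [x' [y' [Qx' Qy' ->]]]; exists (x + x'), (y + y').
by split; rewrite ?rpredD //; ring.
Qed.

Lemma in_QsgM z w : in_Qsg z -> in_Qsg w -> in_Qsg (z * w).
Proof.
move=> [x [y [Qx Qy ->]]] [x' [y' [Qx' Qy' ->]]].
exists (x * x' - 2 * (y * y')), (x * y' + y * x').
split; first by rewrite rpredB ?rpredM // rpred_nat.
  by rewrite rpredD ?rpredM.
have -> : (x + y * sg) * (x' + y' * sg) =
          x * x' + y * y' * sg ^+ 2 + (x * y' + y * x') * sg by ring.
by rewrite sg2; ring.
Qed.

Lemma in_Qsg_rat x : x \in Crat -> in_Qsg x.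
Proof. by exists x, 0; rewrite rpred0 mul0r addr0. Qed.

Lemma in_Qsg_sg : in_Qsg sg.
Proof. by exists 0, 1; rewrite rpred0 rpred1 mul1r add0r. Qed.

Lemma in_Qsg_sum (I : finType) (P : pred I) (f : I -> algC) :
  (forall i, in_Qsg (f i)) -> in_Qsg (\sum_(i | P i) f i).
Proof.
move=> H; apply: big_ind => //; first by apply: in_Qsg_rat; rewrite rpred0.
exact: in_QsgD.
Qed.

Lemma sg_coef_eq (x y x' y' : int) :
  x%:~R + y%:~R * sg = x'%:~R + y'%:~R * sg -> x = x'.
Proof.
move=> E; have := congr1 (fun z => z + z^*) E.
rewrite !rmorphD !rmorphM /= !rmorph_int sgC => E2.
have dbl (k l : int) : (k * 2)%:~R = k%:~R + l%:~R * sg + (k%:~R + l%:~R * - sg).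
  by rewrite intrM; ring.
have : (x * 2)%:~R = (x' * 2)%:~R :> algC by rewrite (dbl _ y) E2 -dbl.
by move/intr_inj/(mulIf (_ : 2 != 0 :> int)); apply.
Qed.

(** The ring of integers of Q(sqrt -2) is Z[sqrt -2]. The numbers X = 2x, Y = 4y and n = x^2 + 2 y^2
    are rational algebraic integers with Y^2 + 2 X^2 = 8 n; reading this equation modulo 2 three
    times halves Y, then X, then Y again. *)
Lemma Zsg_integral z : in_Qsg z -> z \in Aint ->
  exists x y : int, z = x%:~R + y%:~R * sg.
Proof.
move=> [x [y [Qx Qy ->]]] Az.
set z0 := x + y * sg in Az *.
have Cz : z0^* = x - y * sg.
  by rewrite /z0 rmorphD rmorphM /= sgC !conj_Crat // mulrN.
have Azc : z0^* \in Aint by rewrite Aint_aut.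
have ints t : t \in Crat -> t \in Aint -> exists k : int, t = k%:~R.
  by move=> Qt At; apply/intrP; apply: Cint_rat_Aint.
have [||X EX] := ints (2 * x).
- by rewrite rpredM ?rpred_nat.
- have -> : 2 * x = z0 + z0^* by rewrite Cz /z0; ring.
  by rewrite rpredD.
have [||Y EY] := ints (4 * y).
- by rewrite rpredM ?rpred_nat.
- have -> : 4 * y = - ((z0 - z0^*) * sg).
    have -> : (z0 - z0^*) * sg = 2 * y * sg ^+ 2 by rewrite Cz /z0; ring.
    by rewrite sg2; ring.
  by rewrite rpredN rpredM // rpredB.
have [||n En] := ints (x ^+ 2 + 2 * y ^+ 2).
- by rewrite rpredD ?rpredM ?rpred_nat ?rpredX.
- have -> : x ^+ 2 + 2 * y ^+ 2 = z0 * z0^*.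
    have -> : z0 * z0^* = x ^+ 2 - y ^+ 2 * sg ^+ 2 by rewrite Cz /z0; ring.
    by rewrite sg2; ring.
  by rewrite rpredM.
have E : Y * Y = 2 * (4 * n - X * X).
  apply: (@intr_inj algC); rewrite !(rmorphM, rmorphB) /= -EX -EY -En; ring.
have dbl (k l : int) : k * k = 2 * l -> exists h, k = 2 * h.
  move=> Ek; have /dvdzP [h ->] : (2 %| k)%Z.
    by rewrite -(@dvdz_primeX2 2) // expr2 Ek dvdz_mulr.
  by exists h; rewrite mulrC.
have n2 : 2 != 0 :> int by [].
have [Y1 EY1] := dbl _ _ E.
have E1 : X * X = 2 * (2 * n - Y1 * Y1).
  by apply: (mulfI n2); move: E; rewrite EY1; lia.
have [X1 EX1] := dbl _ _ E1.
have E3 : Y1 * Y1 = 2 * (n - X1 * X1).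
  by apply: (mulfI n2); move: E1; rewrite EX1; lia.
have [Y2 EY2] := dbl _ _ E3; exists X1, Y2; rewrite /z0; congr (_ + _ * _).
  apply: (mulfI (_ : 2 != 0 :> algC)); first by rewrite pnatr_eq0.
  by rewrite EX EX1 rmorphM.
apply: (mulfI (_ : 4 != 0 :> algC)); first by rewrite pnatr_eq0.
by rewrite EY EY1 EY2 !rmorphM /=; ring.
Qed.

End QuadraticField.

Lemma expr_coprime_eq1 (R : nzRingType) (x : R) a b : coprime a b ->
  (0 < a)%N -> x ^+ a = 1 -> x ^+ b = 1 -> x = 1.
Proof.
move=> co a0 xa xb; case: (egcdnP b a0) => u v E _.
rewrite (eqP co) in E; have := congr1 (fun k => x ^+ k) E.
by rewrite exprD expr1 mulnC exprM xa expr1n mulnC exprM xb expr1n mul1r => <-.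
Qed.

(** The factor [e.-1] stands for -1 modulo [e] in exponents of characters; this is (-a)(-b) = ab
    modulo [e]. *)
Lemma mul_pred_pred e a b : (1 < e)%N ->
  (e.-1 * a * (e.-1 * b) = a * b * e.-2 * e + a * b)%N.
Proof. by case: e => [|[|e]] // _ /=; nia. Qed.

(** * Gauss sums of 2-power order *)

Section GaussSums.
Variables (p s m : nat) (F : finFieldType).
Hypotheses (p_pr : prime p) (p3 : (p %% 8 = 3)%N) (s_gt0 : (0 < s)%N).
Hypotheses (cardF : #|F| = (p ^ s)%N) (m3 : (3 <= m)%N).
Hypotheses (dvq : (2 ^ m %| #|F|.-1)%N) (ndvq : ~~ (2 ^ m.+1 %| #|F|.-1)%N).
Variables (g : F) (zp z : algC).
Hypotheses (Hg : #|F|.-1.-primitive_root g) (Hzp : p.-primitive_root zp).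
Hypothesis Hz : (2 ^ m).-primitive_root z.

Local Notation e := (2 ^ m)%N.
Local Notation q := #|F|.
(** The powers of [chi] with exponents [h], [2 * M] and [M] have orders 2, 4 and 8. *)
Local Notation h := (2 ^ m.-1)%N.
Local Notation M := (2 ^ (m - 3))%N.

Definition chi := pow_char g z.
Definition psi := @psiF F p s zp.
(** For [k > 0] the power of [chi] vanishes at 0, but for [k = 0] it is 1 there; hence the
    positivity conditions when exponents are compared modulo [e]. *)
Definition gs k := gauss psi (fun x => chi x ^+ k).

Let charF : p \in [pchar F] := card_finPcharP cardF p_pr.
Let apsi : add_char psi := add_char_psiF p_pr cardF Hzp.
Let npsi : nontriv_add psi := nontriv_psiF p_pr cardF s_gt0 Hzp.

Lemma odd_p : odd p. Proof. by move: p3; clear; lia. Qed.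

Lemma eM : e = (8 * M)%N.
Proof. by rewrite -(expnD 2 3); congr expn; lia. Qed.
Lemma hM : h = (4 * M)%N.
Proof. by rewrite -(expnD 2 2); congr expn; lia. Qed.
Lemma M_gt0 : (0 < M)%N. Proof. by rewrite expn_gt0. Qed.

Lemma q_gt1 : (1 < q)%N. Proof. exact: card_finNzRing_gt1. Qed.

Lemma zq1 : z ^+ q.-1 = 1.
Proof. by apply/eqP; rewrite -(prim_order_dvd Hz). Qed.

Let mchi : mult_char chi := mult_char_pow Hg zq1.

Lemma chi0 : chi 0 = 0. Proof. by case: mchi. Qed.
Lemma chi1 : chi 1 = 1. Proof. by case: mchi. Qed.
Lemma chiM : {morph chi : x y / x * y}. Proof. by case: mchi. Qed.
Lemma chiX x k : chi (x ^+ k) = chi x ^+ k.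
Proof. by elim: k => [|k IH]; rewrite ?chi1 // !exprS chiM IH. Qed.

Lemma chi_e x : x != 0 -> chi x ^+ e = 1.
Proof.
by move=> x0; rewrite /chi /pow_char (negPf x0) exprAC (prim_expr_order Hz) expr1n.
Qed.

Lemma chi_g : chi g = z.
Proof. by rewrite -[g]expr1 /chi pow_char_gen // zq1. Qed.

Lemma mchiX k : (0 < k)%N -> mult_char (fun x => chi x ^+ k).
Proof. by move=> k0; apply: mult_charX. Qed.

Lemma nchiX k : ~~ (e %| k)%N -> nontriv_mult (fun x => chi x ^+ k).
Proof.
move=> nk; exists g; first by rewrite -[g]expr1 (gen_neq0 Hg).
by rewrite chi_g -(prim_order_dvd Hz).
Qed.

Lemma ndvd_gt0 k : ~~ (e %| k)%N -> (0 < k)%N.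
Proof. by case: k => //; rewrite dvdn0. Qed.

(** The value has order dividing both a power of 2 and p - 1, which is twice an odd number. *)
Lemma chi_Fp c : c != 0 -> chi (@iota_Fp F p c) ^+ 2 = 1.
Proof.
move=> c0; set x := iota_Fp F c.
have x0 : x != 0 by rewrite (iota_Fp_eq0 p_pr cardF).
have xp : x ^+ p.-1 = 1.
  apply: (mulfI x0); rewrite mulr1 -exprS prednK ?prime_gt0 //.
  by have := iota_FpX p_pr cardF c 1; rewrite expn1.
apply: (@expr_coprime_eq1 _ _ p./2 e).
- by rewrite coprimeXr // coprimen2; move: p3; clear; lia.
- by move: p3; clear; lia.
- rewrite -exprM (_ : (2 * p./2)%N = p.-1); last by move: p3; clear; lia.
  by rewrite -chiX xp chi1.
- by rewrite exprAC chi_e // expr1n.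
Qed.

Lemma chi_4 : chi 4 = 1.
Proof.
have -> : 4 = (2 : F) ^+ 2 by ring.
have E : 2 = iota_Fp F (2 : 'F_p) by rewrite -(iota_natr p_pr cardF 2).
rewrite chiX E chi_Fp // -(iota_Fp_eq0 p_pr cardF) -E.
rewrite -(dvdn_pcharf charF) gtnNdvd //.
by move: p3; clear; case: p => [|[|[|]]].
Qed.

Lemma N1_neq1 : (-1 : F) != 1.
Proof.
rewrite eq_sym -subr_eq0 opprK -(dvdn_pcharf charF 2) gtnNdvd //.
by move: p3; clear; case: p => [|[|[|]]].
Qed.

(** If [chi (-1)] were 1, then 2^m would divide the index of -1, which is half of an odd multiple of
    q - 1; so 2^(m+1) would divide q - 1. *)
Lemma chi_N1 : chi (-1) = -1.
Proof.
have nz : (-1 : F) != 0 by rewrite oppr_eq0 oner_eq0.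
have E2 : chi (-1) ^+ 2 = 1 by rewrite -chiX sqrrN expr1n chi1.
have /eqP := E2; rewrite sqrf_eq1 => /orP [] /eqP // E1; exfalso.
have Ei := indK Hg nz; set i := ind g (-1) in Ei.
have ei : (e %| i)%N.
  by rewrite (prim_order_dvd Hz) -E1 /chi /pow_char (negPf nz).
have q2i : (q.-1 %| 2 * i)%N.
  by rewrite (prim_order_dvd Hg) mulnC exprM Ei sqrrN expr1n.
have nqi : ~~ (q.-1 %| i)%N by rewrite (prim_order_dvd Hg) Ei N1_neq1.
case/dvdnP: q2i => t Et.
have ot : odd t.
  apply: contraR nqi => /negPf et; apply/dvdnP; exists t./2.
  by move: Et; rewrite -[in (t * _)%N](odd_double_half t) et add0n -muln2; lia.
case/negP: ndvq; have co : coprime (2 ^ m.+1) t by rewrite coprimeXl // coprime2n.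
by rewrite -(Gauss_dvdr _ co) -Et expnS dvdn_pmul2l.
Qed.

Lemma gs_mod k l : (0 < k)%N -> (0 < l)%N -> k = l %[mod e] -> gs k = gs l.
Proof.
move=> k0 l0 E; apply: eq_bigr => x _; congr (_ * _).
have [->|x0] := eqVneq x 0.
  by rewrite chi0 !expr0n (gtn_eqF k0) (gtn_eqF l0).
by rewrite -(expr_mod _ (chi_e x0)) E expr_mod // chi_e.
Qed.

Lemma gs_frob k : gs (p * k) = gs k.
Proof.
have inj : injective (fun x : F => x ^+ p).
  by move=> x y; rewrite -!(pFrobenius_autE charF) => /fmorph_inj.
rewrite /gs /gauss [RHS](reindex_inj inj); apply: eq_bigr => x _.
by rewrite chiX -exprM /psi psiF_frob.
Qed.

Lemma gs_class c k : (c %% 8 = 1)%N \/ (c %% 8 = 3)%N -> (0 < k)%N ->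
  gs (c * k) = gs k.
Proof.
move=> Hc k0; have [j Ej] := pow_mod_two p3 m3 Hc.
have <- : gs (p ^ j * k) = gs k.
  by elim: j {Ej} => [|j IH]; rewrite ?mul1n // expnS -mulnA gs_frob.
apply: gs_mod; rewrite ?muln_gt0 ?k0 ?andbT ?expn_gt0 ?(prime_gt0 p_pr) //.
  by move: Hc; clear; lia.
by rewrite -modnMml -Ej modnMml.
Qed.

Lemma gs_norm k : ~~ (e %| k)%N -> gs k * (gs k)^* = q%:R.
Proof.
move=> nk; apply: gauss_norm => //; last exact: nchiX.
exact: mchiX (ndvd_gt0 nk).
Qed.

Lemma gs_neq0 k : ~~ (e %| k)%N -> gs k != 0.
Proof.
move=> nk; apply/eqP => E; have /eqP := gs_norm nk.
by rewrite E mul0r eq_sym pnatr_eq0 eqn0Ngt (ltnW q_gt1).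
Qed.

Lemma gs_conj k : (0 < k)%N -> (gs k)^* = (-1) ^+ k * gs (e.-1 * k).
Proof.
move=> k0; rewrite /gs gauss_conj //; last exact: mchiX.
rewrite chi_N1; congr (_ * _); apply: eq_bigr => x _; congr (_ * _).
have e1 : (0 < e.-1)%N by rewrite eM; have := M_gt0; lia.
have [->|x0] := eqVneq x 0.
  by rewrite chi0 !expr0n (gtn_eqF k0) muln_eq0 (gtn_eqF k0) (gtn_eqF e1) rmorph0.
rewrite rmorphXn exprM /=; congr (_ ^+ _).
apply: (mulfI (mult_char_neq0 mchi x0)); rewrite mult_char_conj // -exprS.
by rewrite prednK ?expn_gt0 // chi_e.
Qed.

(** As 8 divides [e], negation modulo [e] exchanges the classes 5, 7 with 3, 1 modulo 8. *)
Lemma gs_class_neg c k : (c %% 8 = 5)%N \/ (c %% 8 = 7)%N -> (0 < k)%N ->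
  gs (c * k) = gs (e.-1 * k).
Proof.
move=> Hc k0.
have M0 := M_gt0; have E := eM.
have c0 : (0 < c)%N by move: Hc; clear; lia.
have c8 : (e.-1 * c %% 8 = 1)%N \/ (e.-1 * c %% 8 = 3)%N.
  have -> : (e.-1 * c = 8 * (c * M.-1) + 7 * c)%N by rewrite E; move: M0; clear; case: M => // k _; nia.
  by rewrite mulnC modnMDl -modnMmr; case: Hc => ->; [right|left].
rewrite -(gs_class c8 (k := (e.-1 * k)%N)); last by rewrite muln_gt0 k0 andbT E; lia.
apply: gs_mod; rewrite ?muln_gt0 ?k0 ?c0 ?andbT //; first by rewrite E; lia.
have e2 : (1 < e)%N by rewrite E; move: M0; clear; lia.
by rewrite mul_pred_pred // modnMDl.
Qed.

Lemma card_sqr_set d : #|[set x : F | x ^+ 2 == d]|%:R = 1 + chi d ^+ h.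
Proof.
have h0 : (0 < h)%N by rewrite expn_gt0.
have Eh : e = (h * 2)%N by rewrite -expnSr prednK //; apply: leq_trans m3.
have H2 : 2.-primitive_root (z ^+ h).
  have := @dvdn_prim_root _ _ _ Hz 2; rewrite {2}Eh mulnK //.
  by apply; rewrite Eh dvdn_mull.
rewrite (card_root_set Hg (f := 2) (z := z ^+ h)) //; last first.
  by apply: dvdn_trans dvq; rewrite Eh dvdn_mull.
rewrite big_ord_recl big_ord1 expr0 expr1; congr (_ + _).
rewrite /chi /pow_char; case: eqP => _; last by rewrite exprAC.
by rewrite expr0n (gtn_eqF h0).
Qed.

(* Hasse-Davenport for the prime 2; the usual factor [chi 4 ^+ k] is 1 by [chi_4]. *)
Lemma gs_double k : ~~ (e %| 2 * k)%N ->
  gs k * gs (k + h) = gs (2 * k) * gs h.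
Proof.
move=> n2k.
have Eh : e = (h * 2)%N by rewrite -expnSr prednK //; apply: leq_trans m3.
have nk : ~~ (e %| k)%N by apply: contra n2k => ek; rewrite dvdn_mull.
have nkh : ~~ (e %| k + h)%N.
  apply: contra n2k => ek; have : (e %| 2 * (k + h))%N by rewrite dvdn_mull.
  by rewrite mulnDr addnC [(2 * h)%N]mulnC -Eh dvdn_addr.
have k0 := ndvd_gt0 nk.
have gM a b : (0 < a)%N -> (0 < b)%N -> ~~ (e %| a + b)%N ->
    gs a * gs b = jacobi (fun x => chi x ^+ a) (fun x => chi x ^+ b) * gs (a + b).
  move=> a0 b0 nab; rewrite /gs gauss_jacobi //; try exact: mchiX.
    by congr (_ * _); apply: eq_bigr => x _; rewrite exprD.
  by have [x x0 Hx] := nchiX nab; exists x => //; rewrite -exprD.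
have E1 := gM _ _ k0 k0; rewrite addnn -mul2n in E1.
have E2 := gM k h k0 _ nkh.
have n2 : 2 != 0 :> F.
  rewrite -(dvdn_pcharf charF) gtnNdvd //.
  by move: p3; clear; case: p => [|[|[|]]].
have := jacobi_diag n2 (mchiX k0) (nchiX nk) card_sqr_set.
rewrite chi_4 expr1n mul1r => EJ.
(* By [jacobi_diag] the Jacobi sum in [E1] equals the one in [E2]; after multiplication by [gs k]
   the two relations combine. *)
apply: (mulfI (gs_neq0 nk)); rewrite mulrA E1 // EJ.
by rewrite mulrCA E2 ?expn_gt0 //; ring.
Qed.

Lemma ndvd_M k : (0 < k < 8)%N -> ~~ (e %| k * M)%N.
Proof.
by case/andP=> k0 k8; rewrite eM dvdn_pmul2r ?M_gt0 // gtnNdvd.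
Qed.

(** For k = 2^(m-r) one has k + h = (1 + 2^(r-1)) k, and for r >= 4 the multiplier is 1 modulo 8, so
    the two factors in [gs_double] coincide. For r = 3 the multiplier is 5, which lies in the other
    class. *)
Lemma gs_level r : (4 <= r <= m)%N ->
  gs (2 ^ (m - r)) ^+ 2 = gs (2 ^ (m - r.-1)) * gs h.
Proof.
case/andP=> r4 rm.
have E2 : (2 ^ (m - r.-1) = 2 * 2 ^ (m - r))%N.
  by rewrite -expnS; congr expn; lia.
rewrite E2 -gs_double; last first.
  by rewrite -E2 dvdn_Pexp2l // -ltnNge; lia.
rewrite expr2; congr (_ * _).
have Eh : h = (8 * 2 ^ (r - 4) * 2 ^ (m - r))%N.
  by rewrite -(expnD 2 3) -expnD; congr expn; lia.
have -> : (2 ^ (m - r) + h = (8 * 2 ^ (r - 4) + 1) * 2 ^ (m - r))%N.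
  by rewrite Eh mulnDl mul1n addnC.
rewrite gs_class ?expn_gt0 //; left.
by rewrite mulnC modnMDl.
Qed.

Definition jac8 := jacobi (fun x => chi x ^+ M) (fun x => chi x ^+ (3 * M)).

(** Frobenius identifies [gs M] with [gs (3 * M)], and the product of these two characters of order
    8 is quadratic. *)
Lemma gs_level3 : gs M ^+ 2 = jac8 * gs h.
Proof.
have M0 := M_gt0.
have -> : gs M ^+ 2 = gs M * gs (3 * M).
  by rewrite expr2 [gs (3 * M)]gs_class //; right.
have nM : ~~ (e %| M + 3 * M)%N by rewrite -mulSn ndvd_M.
rewrite /gs gauss_jacobi //; try by apply: mchiX; lia.
  rewrite hM; congr (_ * _); apply: eq_bigr => x _.
  by rewrite -exprD -mulSn.
by have [x x0 Hx] := nchiX nM; exists x => //; rewrite -exprD.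
Qed.

(** In [gs_double] at [M] the second factor is [gs (5 * M)], which is the conjugate of [gs M] up to
    the sign (-1)^M; the norm gives [q]. *)
Lemma gs_quarter : gs (2 * M) * gs h = (-1) ^+ M * q%:R.
Proof.
have M0 := M_gt0; have nM := @ndvd_M 1 isT; rewrite mul1n in nM.
rewrite -gs_double ?ndvd_M // hM -[(M + _)%N]mulSn gs_class_neg //; last by left.
rewrite -(gs_norm nM) gs_conj //.
have tt : (-1) ^+ M * (-1) ^+ M = 1 :> algC.
  by rewrite -exprMn mulrNN mulr1 expr1n.
by rewrite mulrCA [_ ^+ _ * (_ ^+ _ * _)]mulrA tt mul1r.
Qed.

Lemma gs_h_sqr : gs h ^+ 2 = q%:R.
Proof.
have h0 : (0 < h)%N by rewrite expn_gt0.
have nh : ~~ (e %| h)%N by rewrite hM ndvd_M.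
rewrite -(gs_norm nh) gs_conj // expr2; congr (_ * _).
have -> : (-1) ^+ h = 1 :> algC.
  by rewrite hM -signr_odd oddM expr0.
rewrite mul1r; apply: gs_mod; rewrite // ?muln_gt0 ?h0 ?andbT.
  by rewrite eM; have := M_gt0; lia.
have -> : (e.-1 * h = (h - 1) * e + h)%N.
  by rewrite eM hM; move: M_gt0; clear; case: M => // k _; nia.
by rewrite modnMDl.
Qed.

(** * The square root of -2 among the eighth roots of unity *)

Definition z8 := z ^+ M.
(** The orbit sum of [z8] under cubing, matching the Frobenius classes 1 and 3 modulo 8. *)
Definition sg := z8 + z8 ^+ 3.

Lemma prim_z8 : 8.-primitive_root z8.
Proof.
have := @dvdn_prim_root _ _ _ Hz 8; rewrite eM mulKn //.
by apply; rewrite dvdn_mulr.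
Qed.

Lemma z8_4 : z8 ^+ 4 = -1.
Proof.
have /eqP : (z8 ^+ 4) ^+ 2 = 1 by rewrite -exprM (prim_expr_order prim_z8).
by rewrite sqrf_eq1 -(prim_order_dvd prim_z8) /= => /eqP.
Qed.

Lemma sg_sqr : sg ^+ 2 = - 2.
Proof.
have -> : sg ^+ 2 = z8 ^+ 2 * (1 + z8 ^+ 4) + 2 * z8 ^+ 4 by rewrite /sg; ring.
by rewrite z8_4; ring.
Qed.

Lemma sg_conj : sg^* = - sg.
Proof.
have E : z8^* = - z8 ^+ 3.
  have n0 : z8 != 0.
    by apply/eqP=> Z; have /eqP := z8_4; rewrite Z expr0n eq_sym oppr_eq0 oner_eq0.
  apply: (mulfI n0).
  rewrite (unity_mul_conj _ (prim_expr_order prim_z8)) //.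
  by rewrite mulrN -exprS z8_4 opprK.
have E3 : (z8 ^+ 3)^* = (z8^*) ^+ 3 by rewrite rmorphXn.
rewrite /sg rmorphD /= E3 E.
have -> : (- z8 ^+ 3) ^+ 3 = - (z8 ^+ 4 * z8 ^+ 4 * z8) by ring.
by rewrite z8_4; ring.
Qed.

Lemma sg_Aint : sg \in Aint.
Proof. have A8 := Aint_prim_root prim_z8; exact: (rpredD A8 (rpredX 3 A8)). Qed.

Lemma z8_theta i : z8 ^+ i + z8 ^+ (3 * i) =
  nth 0 [:: 2; sg; 0; sg; - 2; - sg; 0; - sg] (i %% 8).
Proof.
have X := prim_expr_mod prim_z8.
rewrite -[z8 ^+ i]X -[z8 ^+ (3 * i)]X -modnMmr.
have : (i %% 8 < 8)%N by rewrite ltn_mod.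
have e5 : z8 ^+ 5 = - z8 by rewrite (exprD _ 4 1) z8_4 mulN1r.
have e6 : z8 ^+ 6 = - z8 ^+ 2 by rewrite (exprD _ 4 2) z8_4 mulN1r.
have e7 : z8 ^+ 7 = - z8 ^+ 3 by rewrite (exprD _ 4 3) z8_4 mulN1r.
case: (i %% 8)%N => [|[|[|[|[|[|[|[|]]]]]]]] // _;
  rewrite /= /modn /= ?e5 ?e6 ?e7 ?z8_4 /sg; ring.
Qed.

(** The geometric sum in [w ^+ 8] vanishes unless [w] is a power of [z8], and then [z8_theta]
    applies. *)
Lemma in_Qsg_theta w : w ^+ e = 1 ->
  in_Qsg sg (\sum_(a < M) (w ^+ (8 * a + 1) + w ^+ (8 * a + 3))).
Proof.
move=> we; rewrite (_ : \sum_(a < M) _ = (\sum_(a < M) (w ^+ 8) ^+ a) * (w + w ^+ 3)).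
  rewrite sum_geometric_unity; last by rewrite -exprM -eM.
  case: eqP => [w8|_]; last by rewrite mul0r; apply: in_Qsg_rat; rewrite rpred0.
  apply: in_QsgM; first exact: sg_sqr.
    by apply: in_Qsg_rat; rewrite rpred_nat.
  have [i ->] := prim_rootP prim_z8 w8.
  rewrite -[(z8 ^+ i) ^+ 3]exprM [(i * 3)%N]mulnC z8_theta modn_small //.
  have Qs := in_Qsg_sg sg.
  have Qn : in_Qsg sg (- sg).
    by rewrite -mulN1r; apply: in_QsgM => //; [exact: sg_sqr | apply: in_Qsg_rat; rewrite rpredN rpred1].
  have Q0 : in_Qsg sg 0 by apply: in_Qsg_rat; rewrite rpred0.
  have Q2 : in_Qsg sg 2 by apply: in_Qsg_rat; rewrite rpred_nat.
  have Q2n : in_Qsg sg (- 2) by apply: in_Qsg_rat; rewrite rpredN rpred_nat.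
  by case: i => [] [|[|[|[|[|[|[|[|i]]]]]]]].
rewrite mulr_suml; apply: eq_bigr => a _.
by rewrite -exprM !exprD; ring.
Qed.

(** * The restriction of [chi] to the prime field *)

Definition chip (c : 'F_p) := chi (iota_Fp F c).
(** [chip] is the Legendre symbol, because it is nontrivial with values 1 and -1 on nonzero
    elements; [gp] is thus a square root of -p. *)
Definition gp := gauss (psi0 zp) chip.

Let apsi0 : add_char (psi0 zp) := add_char_psi0 p_pr Hzp.
Let npsi0 : nontriv_add (psi0 zp) := nontriv_psi0 p_pr Hzp.

Lemma mult_char_chip : mult_char chip.
Proof.
rewrite /chip; split=> [||c d].
- by rewrite (iota_Fp0 p_pr cardF) chi0.
- by rewrite (iota_Fp1 p_pr cardF) chi1.
- by rewrite (iota_FpM p_pr cardF) chiM.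
Qed.

Lemma chip_N1 : chip (-1) = -1.
Proof.
rewrite -chi_N1; congr chi; apply/eqP; rewrite -addr_eq0.
by rewrite -(iota_Fp1 p_pr cardF) -(iota_FpD p_pr cardF) addNr (iota_Fp0 p_pr cardF).
Qed.

Lemma chip_conj c : (chip c)^* = chip c.
Proof.
have [->|c0] := eqVneq c 0; first by case: mult_char_chip => -> _ _; rewrite rmorph0.
apply: (mulfI (mult_char_neq0 mult_char_chip c0)).
by rewrite (mult_char_conj mult_char_chip c0) -expr2 chi_Fp.
Qed.

Lemma chip_Crat c : chip c \in Crat.
Proof.
have [->|c0] := eqVneq c 0; first by case: mult_char_chip => -> _ _; rewrite rpred0.
have /eqP := chi_Fp c0; rewrite sqrf_eq1 => /orP [] /eqP E; rewrite /chip E.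
  by rewrite rpred1.
by rewrite rpredN rpred1.
Qed.

Lemma nontriv_chip : nontriv_mult chip.
Proof.
exists (-1); first by rewrite oppr_eq0 oner_eq0.
by rewrite chip_N1 eqNr oner_eq0.
Qed.

Lemma gp_norm : gp * gp^* = p%:R.
Proof.
rewrite (gauss_norm apsi0 npsi0 mult_char_chip nontriv_chip).
by rewrite card_Fp.
Qed.

Lemma gp_conj : gp^* = - gp.
Proof.
rewrite /gp (gauss_conj apsi0 mult_char_chip) chip_N1 mulN1r; congr (- _).
by apply: eq_bigr => c _; rewrite chip_conj.
Qed.

Lemma gp_sqr : gp ^+ 2 = - p%:R.
Proof. by rewrite -gp_norm gp_conj mulrN opprK. Qed.

(** Substituting [c * x] for [x], with [c] in the prime field, does not change [gs k]. Summed over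
    the p - 1 nonzero [c], the factors depending on [c] form the Gauss sum [gp] twisted by the trace
    of [x]. *)
Lemma gs_odd k : odd k ->
  p.-1%:R * gs k = gp * \sum_x chip (trFp p s x) * chi x ^+ k.
Proof.
move=> ok; have k0 : (0 < k)%N by case: k ok.
have chipk c : chip c ^+ k = chip c.
  have [->|c0] := eqVneq c 0.
    by case: mult_char_chip => -> _ _; rewrite expr0n (gtn_eqF k0).
  rewrite -(odd_double_half k) ok -muln2 mulnC exprD exprM.
  by rewrite (_ : chip c ^+ 2 = 1) ?expr1n ?mulr1 ?chi_Fp.
have tw c : c != 0 -> gs k = chip c * \sum_x chi x ^+ k * psi0 zp (c * trFp p s x).
  move=> c0; have i0 : iota_Fp F c != 0 by rewrite (iota_Fp_eq0 p_pr cardF).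
  rewrite /gs /gauss -[LHS](sum_mul_shift _ i0) mulr_sumr; apply: eq_bigr => x _.
  rewrite chiM exprMn -/(chip c) chipk /psi /psiF (trFp_scale p_pr cardF).
  by rewrite mulrA.
transitivity (\sum_c chip c * \sum_x chi x ^+ k * psi0 zp (c * trFp p s x)).
  rewrite (bigD1 0) //=; case: mult_char_chip => -> _ _; rewrite mul0r add0r.
  rewrite (eq_bigr (fun=> gs k)); last by move=> c c0; rewrite -tw.
  rewrite sumr_const mulr_natl; congr (_ *+ _).
  by rewrite -[in LHS](card_Fp p_pr) -(cardsC1 (0 : 'F_p)); apply: eq_card => x; rewrite !inE.
under eq_bigr do rewrite mulr_sumr.
rewrite exchange_big mulr_sumr; apply: eq_bigr => x _ /=.
transitivity (chi x ^+ k * \sum_c chip c * psi0 zp (trFp p s x * c)).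
  by rewrite mulr_sumr; apply: eq_bigr => c _; rewrite [c * _]mulrC; ring.
have [->|t0] := eqVneq (trFp p s x) 0.
  case: (mult_char_chip) => -> _ _; rewrite mul0r mulr0.
  under eq_bigr => c _ do
    (rewrite mul0r; case: apsi0 => -> _ _; rewrite mulr1).
  by rewrite (sum_mult_char mult_char_chip nontriv_chip) mulr0.
rewrite (gauss_twist _ mult_char_chip t0) chip_conj -/gp; ring.
Qed.

(* Averaging [gs c = gs 1] over the residues [c = 1, 3] modulo 8 replaces the
   values of [chi] by elements of Q(sqrt -2), and averaging over the scalings
   of [x] by the prime field extracts the factor [gp]. *)
Lemma in_Qsg_gs1 : in_Qsg sg (gp * gs 1).
Proof.
have M0 := M_gt0.
have p1 : (0 < p.-1)%N by have := prime_gt1 p_pr; clear; lia.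
(* The number of averaged residues times the number of scalings. *)
pose c : algC := (2 * M)%:R * p.-1%:R.
have c0 : c != 0 by rewrite mulf_neq0 // pnatr_eq0; move: M0 p1; clear; lia.
have E : c * (gp * gs 1) = - p%:R * \sum_x chip (trFp p s x) *
    \sum_(a < M) (chi x ^+ (8 * a + 1) + chi x ^+ (8 * a + 3)).
  transitivity (gp * \sum_(a < M) (p.-1%:R * gs (8 * a + 1) + p.-1%:R * gs (8 * a + 3))).
    rewrite (eq_bigr (fun=> 2 * (p.-1%:R * gs 1))); last first.
      move=> a _; rewrite -[(8 * a + 1)%N]muln1 -[(8 * a + 3)%N]muln1.
      rewrite !gs_class // ?muln1.
      + by ring.
      + by right; rewrite mulnC modnMDl.
      + by left; rewrite mulnC modnMDl.
    by rewrite sumr_const card_ord -[_ *+ M]mulr_natr /c natrM; ring.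
  rewrite -gp_sqr expr2 -[RHS]mulrA; congr (_ * _).
  rewrite mulr_sumr; under [in RHS]eq_bigr do rewrite mulr_sumr mulr_sumr.
  rewrite exchange_big /=; apply: eq_bigr => a _.
  have [o1 o3] : odd (8 * a + 1) /\ odd (8 * a + 3) by clear; split; lia.
  rewrite !gs_odd // -mulrDr -big_split mulr_sumr.
  by apply: eq_bigr => x _; rewrite !mulrDr.
have -> : gp * gs 1 = c^-1 * (c * (gp * gs 1)) by rewrite mulKf.
have s2 := sg_sqr.
apply: in_QsgM => //.
  by apply: in_Qsg_rat; rewrite rpredV rpredM ?rpred_nat.
rewrite E; apply: in_QsgM => //; first by apply: in_Qsg_rat; rewrite rpredN rpred_nat.
apply: in_Qsg_sum => x; have [->|x0] := eqVneq x 0.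
  rewrite chi0 big1 ?mulr0; first by apply: in_Qsg_rat; rewrite rpred0.
  by move=> a _; rewrite !expr0n !addn_eq0 !andbF addr0.
apply: in_QsgM => //; first exact: in_Qsg_rat (chip_Crat _).
exact: in_Qsg_theta (chi_e x0).
Qed.

Lemma chi_Aint x : chi x \in Aint.
Proof.
rewrite /chi /pow_char; case: eqP => _; first by rewrite rpred0.
by rewrite rpredX // (Aint_prim_root Hz).
Qed.

Lemma gs_Aint k : gs k \in Aint.
Proof.
apply: rpred_sum => x _; apply: rpredM; first by rewrite rpredX ?chi_Aint.
exact: psiF_Aint Hzp _.
Qed.

Lemma gp_Aint : gp \in Aint.
Proof.
apply: rpred_sum => c _; apply: rpredM; first exact: chi_Aint.
by apply: rpredX; apply: Aint_prim_root Hzp.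
Qed.

Lemma ndvd_1 : ~~ (e %| 1)%N.
Proof. by rewrite gtnNdvd // eM; have := M_gt0; clear; lia. Qed.

(** The product is an integer of Q(sqrt -2) of norm p q. *)
Lemma gs_top : exists X Y : int,
  gp * gs 1 = X%:~R + Y%:~R * sg /\ X ^+ 2 + 2 * Y ^+ 2 = (p ^ s.+1)%N%:Z.
Proof.
have [|X [Y E]] := Zsg_integral sg_sqr sg_conj sg_Aint in_Qsg_gs1.
  by rewrite rpredM ?gp_Aint ?gs_Aint.
exists X, Y; split=> //; apply: (@intr_inj algC).
transitivity ((gp * gs 1) * (gp * gs 1)^*); last first.
  by rewrite rmorphM /= mulrACA gp_norm gs_norm ?ndvd_1 // -natrM cardF -expnS pmulrn.
have -> : (gp * gs 1)^* = X%:~R + Y%:~R * - sg.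
  by rewrite E rmorphD !rmorphM /= !rmorph_int sg_conj.
rewrite E; have -> : (X%:~R + Y%:~R * sg) * (X%:~R + Y%:~R * - sg) =
  X%:~R ^+ 2 - Y%:~R ^+ 2 * sg ^+ 2 by ring.
by rewrite sg_sqr rmorphD rmorphM /= !rmorphXn /=; ring.
Qed.

(** * The Jacobi sum of order 8 modulo [p] *)

Local Notation kap := (q.-1 %/ 8)%N.

Lemma kapE : q.-1 = (8 * kap)%N.
Proof.
by rewrite mulnC divnK //; apply: dvdn_trans dvq; rewrite eM dvdn_mulr.
Qed.

Lemma kap_gt0 : (0 < kap)%N.
Proof. by have := card_pred_gt0 F; rewrite kapE; clear; lia. Qed.

Lemma kapS : (8 * kap).+1 = (p ^ s)%N.
Proof. by rewrite -kapE -cardF prednK // (ltnW q_gt1). Qed.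

Lemma power_sum n : (0 < n)%N ->
  \sum_(x : F) x ^+ n = if (q.-1 %| n)%N then -1 else 0.
Proof.
move=> n0; case: ifP => [/dvdnP [t En]|nd].
  rewrite (bigD1 0) //= expr0n.
  rewrite (gtn_eqF n0) add0r (eq_bigr (fun=> 1)); last first.
    by move=> x x0; rewrite En mulnC exprM expf_card_pred // expr1n.
  rewrite sumr_const (_ : #|_| = q.-1); last first.
    by rewrite -(cardsC1 (0 : F)); apply: eq_card => x; rewrite !inE.
  apply/eqP; rewrite -addr_eq0 natr1.
  by rewrite prednK ?(ltnW q_gt1) // -(dvdn_pcharf charF) cardF -{1}[p]expn1 dvdn_exp2l.
have g0 : g != 0 by rewrite -[g]expr1 (gen_neq0 Hg).
have E : \sum_(x : F) x ^+ n = g ^+ n * \sum_(x : F) x ^+ n.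
  rewrite -[LHS](sum_mul_shift _ g0) mulr_sumr.
  by apply: eq_bigr => x _; rewrite exprMn.
have /eqP : (1 - g ^+ n) * \sum_(x : F) x ^+ n = 0 by rewrite mulrBl mul1r -E subrr.
by rewrite mulf_eq0 subr_eq0 eq_sym -(prim_order_dvd Hg) nd => /eqP.
Qed.

Lemma beta_sum A B : (0 < A)%N ->
  \sum_(x : F) x ^+ A * (1 - x) ^+ B =
  \sum_(j < B.+1) (if (q.-1 %| A + j)%N then - ((-1) ^+ j *+ 'C(B, j)) else 0).
Proof.
move=> A0.
transitivity (\sum_(x : F) \sum_(j < B.+1) (-1) ^+ j *+ 'C(B, j) * x ^+ (A + j)).
  apply: eq_bigr => x _; rewrite exprBn_comm; last exact: mulrC.
  rewrite mulr_sumr; apply: eq_bigr => j _.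
  by rewrite expr1n mulr1 exprD mulrnAr mulrnAl; congr (_ *+ _); ring.
rewrite exchange_big /=; apply: eq_bigr => j _.
rewrite -mulr_sumr power_sum ?addn_gt0 ?A0 //.
by case: ifP => _; rewrite ?mulr0 // mulrN1.
Qed.

Lemma beta_sum13 : \sum_(x : F) x ^+ kap * (1 - x) ^+ (3 * kap) = 0.
Proof.
have k0 := kap_gt0; rewrite beta_sum // big1 // => j _.
rewrite gtnNdvd // ?addn_gt0 ?k0 // [X in (_ < X)%N]kapE.
by have := ltn_ord j; move: k0; clear; lia.
Qed.

(** Only exponents divisible by q - 1 = 8 kap contribute. Here they run from 5 kap to 12 kap, so
    just j = 3 kap survives; in [beta_sum13] they stay between kap and 4 kap. *)
Lemma beta_sum57 : \sum_(x : F) x ^+ (5 * kap) * (1 - x) ^+ (7 * kap) =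
  - ((-1) ^+ (3 * kap) *+ 'C(7 * kap, 3 * kap)).
Proof.
have k0 := kap_gt0; rewrite beta_sum ?muln_gt0 ?k0 //.
have lt3 : (3 * kap < (7 * kap).+1)%N by move: k0; clear; lia.
rewrite (bigD1 (Ordinal lt3)) //= big1 ?addr0; last first.
  move=> j /eqP nj; case: ifP => // /dvdnP [t Et]; case: nj; apply: val_inj => /=.
  rewrite [X in (_ = _ * X)%N]kapE in Et.
  have := ltn_ord j; move: Et k0; clear; move: kap (nat_of_ord j) => K i.
  by case: t => [|[|t]]; rewrite ?mul1n; [lia | lia | nia].
by rewrite [X in (X %| _)%N]kapE (_ : (5 * kap + 3 * kap = 8 * kap)%N) ?dvdnn // -mulnDl.
Qed.

(** A quarter of the trace to the rationals of the [i]-th power of a primitive eighth root of unity.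
    By [tau_sum] it can be read in any commutative ring containing a fourth root of -1. *)
Definition tau i : int := nth 0 [:: 1; 0; 0; 0; -1; 0; 0; 0] (i %% 8).

Lemma tau_sum (R : comNzRingType) (w : R) i : w ^+ 4 = -1 ->
  w ^+ i + w ^+ (3 * i) + w ^+ (5 * i) + w ^+ (7 * i) = 4 * (tau i)%:~R.
Proof.
move=> w4; have w8 : w ^+ 8 = 1 by rewrite (exprD _ 4 4) w4 mulrNN mulr1.
rewrite -(expr_mod i w8) -!(expr_mod (_ * i) w8) -(modnMmr 3) -(modnMmr 5) -(modnMmr 7).
rewrite /tau; have : (i %% 8 < 8)%N by rewrite ltn_mod.
have e5 : w ^+ 5 = - w by rewrite (exprD _ 4 1) w4 mulN1r.
have e6 : w ^+ 6 = - w ^+ 2 by rewrite (exprD _ 4 2) w4 mulN1r.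
have e7 : w ^+ 7 = - w ^+ 3 by rewrite (exprD _ 4 3) w4 mulN1r.
case: (i %% 8)%N => [|[|[|[|[|[|[|[|]]]]]]]] // _;
  rewrite /= /modn /= ?e5 ?e6 ?e7 ?w4; ring.
Qed.

Lemma pow_mod8 k : (p ^ k %% 8 = if odd k then 3 else 1)%N.
Proof.
elim: k => // k IH; rewrite expnS -modnMml -modnMmr p3 IH /=.
by case: (odd k).
Qed.

Lemma s_even : ~~ odd s.
Proof.
apply/negP => os; have := pow_mod8 s; rewrite os -kapS.
by move: kap; clear; lia.
Qed.

Lemma gs_h_value : exists d : int, d ^+ 2 = 1 /\ gs h = d%:~R * (p ^ (s %/ 2))%:R.
Proof.
have E : q%:R = (p ^ (s %/ 2))%:R ^+ 2 :> algC.
  by rewrite cardF -natrX -expnM divnK // dvdn2 s_even.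
have /eqP := gs_h_sqr; rewrite E eqf_sqr => /orP [] /eqP ->.
  by exists 1; rewrite mul1r expr1n.
by exists (-1); rewrite rmorphN mulN1r sqrrN expr1n.
Qed.

Lemma gs_h_Crat : gs h \in Crat.
Proof. by have [d [_ ->]] := gs_h_value; rewrite rpredM ?rpred_int ?rpred_nat. Qed.

Lemma ndvd_h : ~~ (e %| h)%N. Proof. by rewrite hM ndvd_M. Qed.

Lemma gs_step j : (j < m - 3)%N -> gs (2 ^ j) ^+ 2 = gs (2 ^ j.+1) * gs h.
Proof.
move=> jm; have := @gs_level (m - j); rewrite (_ : m - (m - j) = j)%N; last lia.
by rewrite (_ : m - (m - j).-1 = j.+1)%N; [apply; lia | lia].
Qed.

Lemma p_neq0 : p%:R != 0 :> algC.
Proof. by rewrite pnatr_eq0 eqn0Ngt prime_gt0. Qed.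

(** Stated for squares because at [j = 0] only [gp * gs 1] lies in the field; its square is -p times
    that of [gs 1]. *)
Lemma in_Qsg_gs_sqr j : (j <= m - 3)%N -> in_Qsg sg (gs (2 ^ j) ^+ 2).
Proof.
have s2 := sg_sqr.
elim: j => [|j IH] jm.
  have -> : gs 1 ^+ 2 = - p%:R^-1 * ((gp * gs 1) * (gp * gs 1)).
    have -> : gp * gs 1 * (gp * gs 1) = gp ^+ 2 * gs 1 ^+ 2 by ring.
    by rewrite gp_sqr mulrA mulrNN mulVf ?mul1r // p_neq0.
  apply: in_QsgM => //; first by apply: in_Qsg_rat; rewrite rpredN rpredV rpred_nat.
  by apply: in_QsgM => //; apply: in_Qsg_gs1.
have -> : gs (2 ^ j.+1) = (gs h)^-1 * gs (2 ^ j) ^+ 2.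
  by rewrite gs_step // mulrCA mulVf ?mulr1 // gs_neq0 // ndvd_h.
have Q : in_Qsg sg ((gs h)^-1 * gs (2 ^ j) ^+ 2).
  apply: in_QsgM => //; last by apply: IH; apply: ltnW.
  by apply: in_Qsg_rat; rewrite rpredV gs_h_Crat.
by rewrite expr2; apply: in_QsgM.
Qed.

Local Notation P01 := (fun x : F => (x != 0) && (1 - x != 0)).
Definition ix (x : F) : nat :=
  (ind g x + 3 * ind g (1 - x)%R)%N.

Lemma jac8E : jac8 = \sum_(x | P01 x) z8 ^+ ix x.
Proof.
have M0 := M_gt0.
have cM x k : (0 < k)%N -> chi x ^+ (k * M) = if x == 0 then 0 else z8 ^+ (k * ind g x).
  move=> k0; rewrite /chi /pow_char; case: eqP => _.
    by rewrite expr0n muln_eq0 (gtn_eqF k0) (gtn_eqF M0).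
  by rewrite /z8 -!exprM; congr (_ ^+ _); rewrite mulnC -mulnA mulnCA.
rewrite [RHS]big_mkcond /=; apply: eq_bigr => x _.
rewrite -[X in chi x ^+ X](mul1n M) !cM // mul1n.
case: (x == 0) => /=; first by rewrite mul0r.
by case: (1 - x == 0) => /=; rewrite ?mulr0 // -exprD.
Qed.

(** Replacing [x] by [1 - x] exchanges the exponents 1 and 3, as does multiplication by 3 modulo
    8. *)
Lemma jac8_three : \sum_(x | P01 x) z8 ^+ (3 * ix x) = jac8.
Proof.
have inj1 : injective (fun x : F => 1 - x) by move=> x y /addrI /oppr_inj.
rewrite jac8E (reindex_inj inj1) /=.
apply: eq_big => [x|x _]; first by rewrite subKr andbC.
rewrite /ix subKr mulnDr mulnA exprD [z8 ^+ (3 * 3 * _)]exprM.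
by rewrite (exprD z8 8 1) (prim_expr_order prim_z8) mul1r expr1 -exprD addnC.
Qed.

Lemma z8_conj k : (z8 ^+ k)^* = z8 ^+ (7 * k).
Proof.
have z1 := prim_expr_order prim_z8.
have E : z8^* = z8 ^+ 7.
  have n0 : z8 != 0.
    by apply/eqP=> Z; have /eqP := z8_4; rewrite Z expr0n eq_sym oppr_eq0 oner_eq0.
  by apply: (mulfI n0); rewrite (unity_mul_conj _ z1) // -exprS z1.
by rewrite exprM -E [LHS]rmorphXn.
Qed.

(* The integer [4 u], for [jac8 = u + v sg], is a sum of values of characters of
   order 8; [sum_tau_F] evaluates the same sum in [F], with [g ^+ kap] for [z8]. *)
Lemma sum_tau : jac8 *+ 2 + jac8^* *+ 2 = (4 * \sum_(x | P01 x) tau (ix x))%:~R.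
Proof.
rewrite [RHS]rmorphM /= [X in _ = _ * X]rmorph_sum /= mulr_sumr.
under eq_bigr do rewrite -(tau_sum _ z8_4).
rewrite !big_split /= jac8_three -jac8E !mulr2n.
have z1 := prim_expr_order prim_z8.
have -> : \sum_(x | P01 x) z8 ^+ (7 * ix x) = jac8^*.
  by rewrite jac8E rmorph_sum; apply: eq_bigr => x _; rewrite /= z8_conj.
have -> : \sum_(x | P01 x) z8 ^+ (5 * ix x) = jac8^*.
  rewrite -jac8_three rmorph_sum; apply: eq_bigr => x _; rewrite /= z8_conj.
  rewrite mulnA -(expr_mod _ z1) -[RHS](expr_mod _ z1); congr (_ ^+ _).
  by rewrite -modnMml -[RHS]modnMml.
by rewrite addrA.
Qed.

(** The four terms of [tau_sum] become beta sums with exponents k kap and 3 k kap. Reducing 3 k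
    modulo 8 gives the pairs (1,3), (3,1), (5,7), (7,5): the first two vanish and the last two agree
    by symmetry. *)
Lemma sum_tau_F : (4 * \sum_(x | P01 x) tau (ix x))%:~R =
  - ((-1) ^+ (3 * kap) *+ 'C(7 * kap, 3 * kap)) *+ 2 :> F.
Proof.
have k0 := kap_gt0.
rewrite [LHS]rmorphM /= [X in _ * X = _]rmorph_sum /= mulr_sumr.
have w4 : (g ^+ kap) ^+ 4 = -1.
  have /eqP : ((g ^+ kap) ^+ 4) ^+ 2 = 1.
    rewrite -!exprM; apply/eqP; rewrite -(prim_order_dvd Hg).
    by rewrite [X in (X %| _)%N]kapE; apply/dvdnP; exists 1%N; move: kap => K; lia.
  rewrite sqrf_eq1 => /orP [|/eqP //]; rewrite -exprM -(prim_order_dvd Hg).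
  by rewrite [X in (X %| _)%N]kapE [(8 * _)%N]mulnC dvdn_pmul2l.
under eq_bigr do rewrite -(tau_sum _ w4).
(* Positivity of [a] is what makes this reduction valid at [x = 0]. *)
have x8 (x : F) a : (0 < a)%N -> x ^+ ((a + 8) * kap) = x ^+ (a * kap).
  move=> a0; rewrite mulnDl exprD -kapE; have [->|x0] := eqVneq x 0.
    by rewrite expr0n muln_eq0 (gtn_eqF a0) (gtn_eqF k0) mul0r.
  by rewrite expf_card_pred // mulr1.
have S k a : (0 < k)%N -> (0 < a)%N ->
    (3 * k = a \/ 3 * k = a + 8 \/ 3 * k = a + 8 + 8)%N ->
    \sum_(x | P01 x) (g ^+ kap) ^+ (k * ix x) =
    \sum_(x : F) x ^+ (k * kap) * (1 - x) ^+ (a * kap).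
  move=> kp a0 Ha; rewrite [LHS]big_mkcond /=; apply: eq_bigr => x _.
  have [->|x0] /= := eqVneq x 0.
    by rewrite expr0n muln_eq0 (gtn_eqF kp) (gtn_eqF k0) mul0r.
  have [->|y0] /= := eqVneq (1 - x) 0.
    by rewrite expr0n muln_eq0 (gtn_eqF a0) (gtn_eqF k0) mulr0.
  have -> : (1 - x) ^+ (a * kap) = (1 - x) ^+ (3 * k * kap).
    by case: Ha => [->|[->|->]] //; rewrite !x8 // addn_gt0 a0.
  have -> : x ^+ (k * kap) = (g ^+ ind g x) ^+ (k * kap) by rewrite indK.
  have -> : (1 - x) ^+ (3 * k * kap) = (g ^+ ind g (1 - x)) ^+ (3 * k * kap).
    by rewrite indK.
  rewrite -!exprM -exprD.
  by congr (_ ^+ _); rewrite /ix; ring.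
have swap A B : \sum_(x : F) x ^+ A * (1 - x) ^+ B = \sum_(x : F) x ^+ B * (1 - x) ^+ A.
  have inj1 : injective (fun x : F => 1 - x) by move=> x y /addrI /oppr_inj.
  by rewrite [LHS](reindex_inj inj1); apply: eq_bigr => x _; rewrite subKr mulrC.
have S1 : \sum_(x | P01 x) (g ^+ kap) ^+ ix x = 0.
  have E := S 1%N 3%N isT isT (or_introl erefl).
  rewrite mul1n beta_sum13 in E; rewrite -[RHS]E.
  by apply: eq_bigr => x _; rewrite mul1n.
rewrite !big_split /= S1 add0r.
rewrite (S 3%N 1%N isT isT (or_intror (or_introl erefl))) mul1n swap beta_sum13.
rewrite (S 5%N 7%N isT isT (or_intror (or_introl erefl))) beta_sum57.
rewrite (S 7%N 5%N isT isT (or_intror (or_intror erefl))) swap beta_sum57.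
by rewrite add0r mulr2n.
Qed.

Lemma jac8_unit : exists u v : int,
  jac8 = u%:~R + v%:~R * sg /\ ~~ (p%:Z %| u)%Z.
Proof.
have Aj : jac8 \in Aint.
  rewrite jac8E; apply: rpred_sum => x _; apply: rpredX.
  exact: Aint_prim_root prim_z8.
have Qj : in_Qsg sg jac8.
  have -> : jac8 = (gs h)^-1 * gs M ^+ 2.
    by rewrite gs_level3 mulrCA mulVf ?mulr1 // gs_neq0 // ndvd_h.
  apply: in_QsgM; first exact: sg_sqr.
    by apply: in_Qsg_rat; rewrite rpredV gs_h_Crat.
  exact: in_Qsg_gs_sqr.
have [u [v Ej]] := Zsg_integral sg_sqr sg_conj sg_Aint Qj Aj.
exists u, v; split=> //; apply/negP => pu.
have Eu : 4 * u = 4 * \sum_(x | P01 x) tau (ix x).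
  apply: (@intr_inj algC); rewrite -sum_tau.
  have -> : jac8^* = u%:~R + v%:~R * - sg.
    by rewrite Ej rmorphD !rmorphM /= !rmorph_int sg_conj.
  by rewrite Ej intrM !mulr2n; ring.
have p2 : ~~ (p %| 2)%N.
  by rewrite gtnNdvd //; move: p3; clear; case: p => [|[|[|]]].
have := sum_tau_F; rewrite -Eu; case/dvdzP: pu => t ->.
have -> : (4 * (t * p%:Z))%:~R = 0 :> F.
  by rewrite !rmorphM /= -[_ p%:Z]/(p%:R) (pcharf0 charF) !mulr0.
move/eqP; rewrite eq_sym -[X in X == 0]mulr_natr mulf_eq0 -(dvdn_pcharf charF) (negPf p2) orbF.
rewrite oppr_eq0 -[X in X == 0]mulr_natr mulf_eq0 signr_eq0 /= -(dvdn_pcharf charF).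
by apply/negP; apply: binomial_ndvd p3 kapS.
Qed.

(** * Power sums of [psi] and a congruence modulo 4 *)

Lemma sum_psi_pow f w y : (f %| q.-1)%N -> f.-primitive_root w ->
  \sum_x psi (y * x ^+ f) =
  \sum_u (\sum_(k < f) pow_char g w u ^+ k) * psi (y * u).
Proof.
move=> fq Hw; rewrite (partition_big (fun x => x ^+ f) predT) //=.
apply: eq_bigr => u _; rewrite -(card_root_set Hg u fq Hw).
under eq_bigr => x /eqP -> do [].
rewrite sumr_const -[LHS]mulr_natl; congr (_%:R * _).
by apply: eq_card => x; rewrite inE.
Qed.

(** Both sides are the sum of psi(x^4). Expanded in characters it gives the left side, the two
    quartic Gauss sums being equal by [gs_class]; counted directly, [x = 0] gives 1 and each nonzero
    fourth power is hit four times. *)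
Lemma quartic_congruence : exists2 t : algC, t \in Aint &
  gs h + 2 * gs (2 * M) = 1 + 4 * t.
Proof.
have M0 := M_gt0.
have E4 : e = (2 * M * 4)%N by rewrite eM; move: M0; clear; lia.
have d4 : (4 %| q.-1)%N by apply: dvdn_trans dvq; rewrite E4 dvdn_mull.
have Hw : 4.-primitive_root (z ^+ (2 * M)).
  by have := @dvdn_prim_root _ _ _ Hz 4; rewrite {2}E4 mulnK //; apply; rewrite E4 dvdn_mull.
have cw u : pow_char g (z ^+ (2 * M)) u = chi u ^+ (2 * M).
  rewrite /chi /pow_char; case: eqP => _; last by rewrite exprAC.
  by rewrite expr0n muln_eq0 (gtn_eqF M0).
have [ps0 _ _] := apsi.
have E := sum_psi_pow 1 d4 Hw.
have E1 : \sum_x psi (1 * x ^+ 4) = gs h + 2 * gs (2 * M).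
  rewrite E; under eq_bigr do rewrite mulr_suml.
  rewrite exchange_big /= !big_ord_recl big_ord0 /= addr0.
  under eq_bigr do rewrite expr0 mul1r mulrC.
  under [X in _ + (X + _)]eq_bigr do rewrite cw mul1r -exprM muln1.
  under [X in _ + (_ + (X + _))]eq_bigr do rewrite cw mul1r -exprM.
  under [X in _ + (_ + (_ + X))]eq_bigr do rewrite cw mul1r -exprM.
  rewrite (sum_add_char 1 apsi npsi) oner_eq0 add0r.
  rewrite -/(gauss psi _) -/(gs _) -/(gauss psi _) -/(gs _) -/(gauss psi _) -/(gs _).
  rewrite (_ : (2 * M * 2 = h)%N); last by rewrite hM; clear; lia.
  have -> : gs (2 * M * bump 0 (bump 0 (bump 0 0))) = gs (2 * M).
    by rewrite mulnC gs_class ?muln_gt0 ?M0 //; right.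
  by ring.
pose t u : algC := if chi u ^+ (2 * M) == 1 then psi u else 0.
exists (\sum_(u | u != 0) t u).
  apply: rpred_sum => u _; rewrite /t; case: ifP => _; last by rewrite rpred0.
  exact: psiF_Aint Hzp _.
rewrite -E1 E (bigD1 0) //= mulr0 ps0 mulr1; congr (_ + _).
  rewrite cw chi0 expr0n muln_eq0 (gtn_eqF M0) /= !big_ord_recl big_ord0.
  by rewrite !expr0n /= !addr0.
rewrite mulr_sumr; apply: eq_bigr => u u0; rewrite mul1r cw /t.
rewrite sum_geometric_unity; last by rewrite -exprM -E4 chi_e.
by case: ifP => _; rewrite ?mul0r ?mulr0.
Qed.

Lemma gs_quarter_value : gs (2 * M) = (-1) ^+ M * gs h.
Proof.
apply: (mulIf (gs_neq0 ndvd_h)).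
by rewrite gs_quarter -gs_h_sqr expr2 mulrA.
Qed.

(** * Comparison of powers of [p] along the tower *)

(** Squaring sends the rational part x to x^2 - 2 y^2, which is 2 x^2 modulo [p] when [p] divides
    the norm, so it stays prime to [p]. *)
Lemma pow_ndvd (a b : int) k : ~~ (p%:Z %| a)%Z -> (p%:Z %| a ^+ 2 + 2 * b ^+ 2)%Z ->
  exists x y : int, [/\ (a%:~R + b%:~R * sg) ^+ (2 ^ k) = x%:~R + y%:~R * sg,
     ~~ (p%:Z %| x)%Z & (p%:Z %| x ^+ 2 + 2 * y ^+ 2)%Z].
Proof.
move=> na nab; elim: k => [|k [x [y [E nx nxy]]]]; first by exists a, b; rewrite expr1.
exists (x ^+ 2 - 2 * y ^+ 2), (2 * x * y); split.
- rewrite expnSr exprM E.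
  have -> : (x%:~R + y%:~R * sg) ^+ 2 =
     x%:~R ^+ 2 + y%:~R ^+ 2 * sg ^+ 2 + 2 * x%:~R * y%:~R * sg by ring.
  by rewrite sg_sqr !(rmorphB, rmorphM, rmorphXn) /=; ring.
- apply/negP => px; have := rpredD px nxy.
  have -> : x ^+ 2 - 2 * y ^+ 2 + (x ^+ 2 + 2 * y ^+ 2) = 2 * x ^+ 2 by ring.
  by rewrite dvdz_primeM // dvdz_primeX2 // (negPf nx) (negPf (prime_ndvdz2 p_pr odd_p)).
- have -> : (x ^+ 2 - 2 * y ^+ 2) ^+ 2 + 2 * (2 * x * y) ^+ 2 =
    (x ^+ 2 + 2 * y ^+ 2) ^+ 2 by ring.
  by rewrite dvdz_primeX2.
Qed.

Lemma pow_content (i j : nat) (x y : int) : ~~ (p%:Z %| x)%Z -> ~~ (p%:Z %| y)%Z ->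
  p%:Z ^+ i * x = p%:Z ^+ j * y -> i = j.
Proof.
have pn0 k : p%:Z ^+ k != 0 by rewrite expf_neq0 // eqz_nat eqn0Ngt prime_gt0.
have aux a b (u v : int) : (a < b)%N -> p%:Z ^+ a * u = p%:Z ^+ b * v -> (p%:Z %| u)%Z.
  move=> ab E; have -> : u = p%:Z * (p%:Z ^+ (b - a.+1) * v).
    apply: (mulfI (pn0 a)); rewrite E [RHS]mulrA [RHS]mulrA -exprSr -exprD.
    by congr (_ ^+ _ * _); move: ab; clear; lia.
  by rewrite dvdz_mulr.
move=> nx ny E; case: (ltngtP i j) => // L; exfalso.
  by case/negP: nx; apply: aux L E.
by case/negP: ny; apply: aux L (esym E).
Qed.

(** The relation [gs_step] iterated [j] times, written without division. *)
Lemma gs1_pow j : (j <= m - 3)%N -> gs 1 ^+ (2 ^ j) * gs h = gs h ^+ (2 ^ j) * gs (2 ^ j).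
Proof.
elim: j => [|j IH] jm; first by rewrite expn0 !expr1 mulrC.
have n0 := gs_neq0 ndvd_h.
have X (w : algC) : w ^+ (2 ^ j.+1) = (w ^+ (2 ^ j)) ^+ 2 by rewrite expnSr exprM.
apply: (mulIf n0); rewrite !X -[LHS]mulrA -expr2 -exprMn (IH (ltnW jm)).
by rewrite exprMn (gs_step jm) mulrA.
Qed.

Lemma gs1_pow_top : gs 1 ^+ (2 * M) * gs h = gs h ^+ (2 * M) * jac8.
Proof.
have n0 := gs_neq0 ndvd_h.
have X (w : algC) : w ^+ (2 * M) = (w ^+ M) ^+ 2 by rewrite mulnC exprM.
apply: (mulIf n0); rewrite !X -[LHS]mulrA -expr2 -exprMn (gs1_pow (leqnn _)).
by rewrite exprMn gs_level3 mulrA.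
Qed.

(* The exponents of [p] on both sides of [gs1_pow_top] must agree. *)
Lemma top_value : exists (c d : nat) (a b : int),
  [/\ s = (2 * M * d)%N, odd d, (2 * c + d = s.+1)%N,
      a ^+ 2 + 2 * b ^+ 2 = (p ^ d)%N%:Z /\ ~~ (p%:Z %| a)%Z &
      gp * gs 1 = p%:R ^+ c * (a%:~R + b%:~R * sg)].
Proof.
have [X [Y [E EXY]]] := gs_top.
have os : odd s.+1 by rewrite /= s_even.
have [c [a [b [EX EY lc Eab na]]]] := sqr_form_primitive p_pr odd_p EXY os.
have Ecd : (2 * c + (s.+1 - 2 * c) = s.+1)%N by move: lc; clear; lia.
move: Eab Ecd; set d := (s.+1 - 2 * c)%N => Eab Ecd.
have od : odd d by move: os; rewrite -Ecd; clear; lia.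
have Egs : gp * gs 1 = p%:R ^+ c * (a%:~R + b%:~R * sg).
  by rewrite E EX EY !rmorphM !rmorphXn /=; ring.
have pab : (p%:Z %| a ^+ 2 + 2 * b ^+ 2)%Z.
  by rewrite Eab dvdzE /= -{1}[p]expn1 dvdn_exp2l //; case: (d) od.
have [x [y [Exy nx _]]] := pow_ndvd (m - 2) na pab.
have E2M : (2 ^ (m - 2) = 2 * M)%N by rewrite -expnS; congr expn; move: m3; clear; lia.
rewrite E2M in Exy.
have [dl [dl2 Eh]] := gs_h_value.
have [u [v [Ej nu]]] := jac8_unit.
have Es : s = (s %/ 2 * 2)%N by rewrite divnK // dvdn2 s_even.
(* Two values of [(gp * gs 1) ^+ (2 * M) * gs h]: one from the factorisation of [gp * gs 1], the
   other from [gs1_pow_top], [gp ^+ 2 = - p] and [gs h ^+ 2 = q]. *)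
have main : p%:R ^+ (2 * M * c + s %/ 2) * (dl%:~R * (x%:~R + y%:~R * sg)) =
    p%:R ^+ (M + s * M) * ((-1) ^+ M * (u%:~R + v%:~R * sg)).
  transitivity ((gp * gs 1) ^+ (2 * M) * gs h).
    by rewrite Egs Eh exprMn Exy natrX exprD -exprM [(c * _)%N]mulnC; ring.
  rewrite exprMn -mulrA gs1_pow_top Ej !exprM gp_sqr gs_h_sqr cardF natrX -exprM.
  by rewrite -[- p%:R]mulN1r exprMn exprD; ring.
have dpm : dl = 1 \/ dl = -1.
  by move/eqP: dl2; rewrite sqrf_eq1 => /orP [] /eqP ->; [left|right].
have main2 : p%:Z ^+ (2 * M * c + s %/ 2) * (dl * x) = p%:Z ^+ (M + s * M) * ((-1) ^+ M * u).
  apply: (sg_coef_eq sg_conj (y := p%:Z ^+ (2 * M * c + s %/ 2) * (dl * y))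
                      (y' := p%:Z ^+ (M + s * M) * ((-1) ^+ M * v))).
  rewrite !rmorphM !rmorphXn /= !rmorphN1.
  by move: main; rewrite !mulrDr !mulrA.
have ndx : ~~ (p%:Z %| dl * x)%Z.
  by case: dpm => ->; rewrite ?mul1r // mulN1r rpredN.
have ndu : ~~ (p%:Z %| (-1) ^+ M * u)%Z.
  by rewrite -signr_odd; case: odd; rewrite ?expr0 ?expr1 ?mul1r // mulN1r rpredN.
have Ec := pow_content ndx ndu main2.
exists c, d, a, b; split=> //.
(* Eliminate [c] between the equality of exponents [Ec] and 2c + d = s + 1. *)
have Ed : (2 * M * d = s)%N; last by [].
have : (2 * (2 * M * c) + s = 2 * M + 2 * (s * M))%N.
  by rewrite {1}Es; move: Ec; clear; move: (2 * M * c)%N (s %/ 2)%N (s * M)%N => *; lia.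
move: Ecd; clear; move: d M => d K Ecd E1.
have : (2 * K * (2 * c + d) = 2 * K * s.+1)%N by rewrite Ecd.
by rewrite mulnDr mulnS; move: E1; rewrite !mulnA [(2 * s * K)%N]mulnAC; lia.
Qed.

Lemma odd_M : odd M = (m == 3).
Proof. by rewrite oddX /= orbF subn_eq0 eqn_leq m3 andbT. Qed.

(** By the quartic congruence and [gs_quarter_value], (1 + 2 (-1)^M) [gs h] is 1 modulo 4, so [gs h]
    is -1 modulo 4. Since s / 2 = M d with [d] odd, p^(s/2) is 3 modulo 8 for m = 3 and 1 otherwise,
    which fixes the sign. *)
Lemma gs_h_sign : gs h = (if m == 3 then 1 else -1) * (p ^ (s %/ 2))%:R.
Proof.
have [c [d [a [b [Es od _ _ _]]]]] := top_value.
have [dl [dl2 Eh]] := gs_h_value.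
have [t At Et] := quartic_congruence.
have Es2 : (s %/ 2 = M * d)%N by rewrite Es -mulnA mulKn.
pose P := (p ^ (s %/ 2))%N; rewrite -/P in Eh *.
have P8 : (P %% 8 = if m == 3 then 3 else 1)%N.
  by rewrite /P pow_mod8 Es2 oddM odd_M od andbT.
have [k Ek] : exists k : int, t = k%:~R.
  apply/intrP; apply: Cint_rat_Aint => //.
  have -> : t = (gs h + 2 * gs (2 * M) - 1) / 4.
    by rewrite Et addrAC subrr add0r [4 * t]mulrC mulfK // pnatr_eq0.
  rewrite gs_quarter_value rpredM ?rpredV ?rpred_nat // rpredB //.
  by rewrite rpredD ?rpredM ?rpred_nat ?rpredX ?rpredN ?gs_h_Crat.
have E : dl * P%:Z + 2 * ((-1) ^+ (m == 3) * (dl * P%:Z)) = 1 + 4 * k.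
  apply: (@intr_inj algC).
  have -> : (1 + 4 * k)%:~R = 1 + 4 * t by rewrite Ek rmorphD rmorphM.
  rewrite -Et.
  rewrite gs_quarter_value -(signr_odd _ M) odd_M Eh.
  by rewrite !(rmorphD, rmorphM, rmorph_sign) /=.
rewrite Eh; congr (_ * _).
have dpm : dl = 1 \/ dl = -1.
  by move/eqP: dl2; rewrite sqrf_eq1 => /orP [] /eqP ->; [left|right].
clearbody P; move: E P8 dpm; clear.
by case: (m == 3) => /=; rewrite ?expr1 ?expr0 ?mulN1r ?mul1r => E P8 [] Ed;
   rewrite Ed ?rmorphN1 // in E *; exfalso; lia.
Qed.

Lemma sqr_mod8 (x : int) : exists t : int,
  x ^+ 2 = 8 * t \/ x ^+ 2 = 8 * t + 1 \/ x ^+ 2 = 8 * t + 4.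
Proof.
have E := divz_eq x 4; set k := (x %/ 4)%Z in E.
have : (x %% 4)%Z = 0 \/ (x %% 4)%Z = 1 \/ (x %% 4)%Z = 2 \/ (x %% 4)%Z = 3.
  by have := modz_ge0 x (isT : (4 : int) != 0); have := ltz_pmod x (isT : (0 < 4 :> int)); lia.
case=> [|[|[]]] R; rewrite R in E; rewrite E.
- by exists (2 * k ^+ 2); left; ring.
- by exists (2 * k ^+ 2 + k); right; left; ring.
- by exists (2 * k ^+ 2 + 2 * k); right; right; ring.
- by exists (2 * k ^+ 2 + 3 * k + 1); right; left; ring.
Qed.

(** This matches the rational part of a square with the normalisation of A_r: [y] is odd in the
    first case and even in the second. *)
Lemma sqr_form_mod4 (x y : int) (P : nat) : x ^+ 2 + 2 * y ^+ 2 = P%:Z ->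
  ((P %% 8 = 3)%N -> (x ^+ 2 - 2 * y ^+ 2 = -1 %[mod 4])%Z) /\
  ((P %% 8 = 1)%N -> (- (x ^+ 2 - 2 * y ^+ 2) = -1 %[mod 4])%Z).
Proof.
have [t Ht] := sqr_mod8 x; have [u Hu] := sqr_mod8 y.
move: (x ^+ 2) (y ^+ 2) Ht Hu => X Y Ht Hu E.
by split=> P8; lia.
Qed.

(** * Identification of the coefficients with A_r and B_r *)

Variables (A B : nat -> int).
Hypothesis HAB : forall r, (2 <= r <= m)%N ->
  [/\ (p ^ (s %/ 2 ^ (r - 2)))%N%:Z = A r ^+ 2 + 2 * B r ^+ 2,
      (A r = -1 %[mod 4])%Z & ~~ (p%:Z %| A r)%Z].

Lemma form_value r (x y : int) : (2 <= r <= m)%N -> (0 < s %/ 2 ^ (r - 2))%N ->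
  x ^+ 2 + 2 * y ^+ 2 = (p ^ (s %/ 2 ^ (r - 2)))%N%:Z -> ~~ (p%:Z %| x)%Z ->
  [/\ x ^+ 2 = A r ^+ 2, y ^+ 2 = B r ^+ 2 & (x = -1 %[mod 4])%Z -> x = A r].
Proof.
move=> rm d0 E nx; have [EA A4 nA] := HAB rm.
have [Ex Ey] := sqr_form_unique p_pr odd_p d0 (esym EA) nA E nx.
split=> // x4; have /eqP := Ex; rewrite eqf_sqr => /orP [] /eqP // Exn.
by move: A4 x4; rewrite Exn; clear; move: (A r) => a; lia.
Qed.

Lemma sqr_sg (x y : int) : (x%:~R + y%:~R * sg) ^+ 2 =
  (x ^+ 2 - 2 * y ^+ 2)%:~R + (2 * x * y)%:~R * sg.
Proof.
have -> : (x%:~R + y%:~R * sg) ^+ 2 =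
     x%:~R ^+ 2 + y%:~R ^+ 2 * sg ^+ 2 + 2 * x%:~R * y%:~R * sg by ring.
by rewrite sg_sqr !(rmorphB, rmorphM, rmorphXn) /=; ring.
Qed.

Lemma sqr_form_double (x y : int) d : (0 < d)%N ->
  x ^+ 2 + 2 * y ^+ 2 = (p ^ d)%N%:Z ->
  ~~ (p%:Z %| x)%Z -> (x ^+ 2 - 2 * y ^+ 2) ^+ 2 + 2 * (2 * x * y) ^+ 2 =
  (p ^ (2 * d))%N%:Z /\ ~~ (p%:Z %| x ^+ 2 - 2 * y ^+ 2)%Z.
Proof.
move=> d0 E nx; split.
  transitivity ((x ^+ 2 + 2 * y ^+ 2) ^+ 2); first by ring.
  by rewrite E -Posz_expn -expnM mulnC.
apply/negP => px.
have pE : (p%:Z %| x ^+ 2 + 2 * y ^+ 2)%Z.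
  by rewrite E dvdzE /= -{1}[p]expn1 dvdn_exp2l.
have := rpredD px pE.
have -> : x ^+ 2 - 2 * y ^+ 2 + (x ^+ 2 + 2 * y ^+ 2) = 2 * x ^+ 2 by ring.
by rewrite dvdz_primeM // dvdz_primeX2 // (negPf nx) (negPf (prime_ndvdz2 p_pr odd_p)).
Qed.

(** Each step squares and divides by [gs h], which is negative here. In the first step
    [gp ^+ 2 = - p] contributes a second sign, so the rational part is a^2 - 2 b^2, with odd
    exponent [d]; in later steps it is the opposite, with even exponent. Both cases of
    [sqr_form_mod4] give -1 modulo 4. *)
Lemma level_lower i d : s = (2 * M * d)%N -> odd d -> (1 <= i <= m - 3)%N ->
  exists b : int, b ^+ 2 = B (m - i) ^+ 2 /\
    gs (2 ^ i) = p%:R ^+ (s %/ 2 - 2 ^ i.-1 * d) * ((A (m - i))%:~R + b%:~R * sg).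
Proof.
move=> Es od; have d0 : (0 < d)%N by case: d od {Es}.
have Es2 : (s %/ 2 = M * d)%N by rewrite Es -mulnA mulKn.
have Er i' : (i' <= m - 3)%N -> (s %/ 2 ^ (m - i' - 2) = 2 ^ i' * d)%N.
  move=> im; have -> : s = (2 ^ i' * d * 2 ^ (m - i' - 2))%N.
    rewrite Es [RHS]mulnAC -expnD -expnS; congr (2 ^ _ * _)%N.
    by move: im m3; clear; lia.
  by rewrite mulnK // expn_gt0.
elim: i => [//|i IH] /andP [_ im].
have m4 : (m == 3) = false by apply/negbTE; move: im m3; clear; lia.
have Eh := gs_h_sign; rewrite m4 mulN1r natrX in Eh.
have hn0 := gs_neq0 ndvd_h.
have step := gs_step im.
have rm : (2 <= m - i.+1 <= m)%N by move: im m3; clear; lia.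
have r0 : (0 < s %/ 2 ^ (m - i.+1 - 2))%N by rewrite Er // muln_gt0 d0 expn_gt0.
have [i0|ip] := posnP i.
  subst i; have [c [d' [a [b [Es' od' Ecd [Eab na] Egs]]]]] := top_value.
  have Ed : d' = d.
    have M0 := M_gt0; apply/eqP.
    by rewrite -(eqn_pmul2l (m := (2 * M)%N)) ?muln_gt0 ?M0 // -Es' -Es.
  subst d'; have [E2 n2] := sqr_form_double d0 Eab na.
  have E3 : (a ^+ 2 - 2 * b ^+ 2) ^+ 2 + 2 * (2 * a * b) ^+ 2 =
     (p ^ (s %/ 2 ^ (m - 1 - 2)))%N%:Z by rewrite E2 Er.
  have [_ EB EA] := form_value rm r0 E3 n2.
  exists (2 * a * b); split=> //.
  rewrite -EA; last by apply: (sqr_form_mod4 Eab).1; rewrite pow_mod8 od.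
  rewrite -sqr_sg expn1 mul1n; apply: (mulIf hn0); rewrite -[LHS]step expn0.
  apply: (mulfI p_neq0); apply: oppr_inj; rewrite -!mulNr -gp_sqr -exprMn Egs exprMn.
  rewrite gp_sqr Eh -exprM -[in LHS](_ : (1 + (s %/ 2 - d) + s %/ 2 = c * 2)%N).
    by rewrite !exprD expr1; ring.
  have L : (d <= s %/ 2)%N by rewrite Es2 leq_pmull // M_gt0.
  have E2' : s = (s %/ 2 * 2)%N by rewrite divnK // dvdn2 s_even.
  by move: Ecd L; rewrite {1}E2'; clear; lia.
have iI : (1 <= i <= m - 3)%N by rewrite ip (ltnW im).
have [b [Eb Egs]] := IH iI; clear IH.
have rm' : (2 <= m - i <= m)%N by move: im m3; clear; lia.
have [EA A4 nA] := HAB rm'; rewrite -Eb (Er _ (ltnW im)) in EA.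
have d0' : (0 < 2 ^ i * d)%N by rewrite muln_gt0 d0 expn_gt0.
have [E2 n2] := sqr_form_double d0' (esym EA) nA.
set x := A (m - i) in EA A4 nA E2 n2 Egs.
have E3 : (- (x ^+ 2 - 2 * b ^+ 2)) ^+ 2 + 2 * (- (2 * x * b)) ^+ 2 =
     (p ^ (s %/ 2 ^ (m - i.+1 - 2)))%N%:Z.
  by rewrite !sqrrN E2 (Er _ im) expnS mulnA.
have n3 : ~~ (p%:Z %| - (x ^+ 2 - 2 * b ^+ 2))%Z by rewrite rpredN.
have [_ EB EAn] := form_value rm r0 E3 n3.
exists (- (2 * x * b)); split=> //.
rewrite -EAn; last first.
  apply: (sqr_form_mod4 (esym EA)).2; rewrite pow_mod8 oddM oddX /=.
  by rewrite (gtn_eqF ip).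
apply: (mulIf hn0); rewrite -[LHS]step Egs exprMn sqr_sg Eh -exprM.
rewrite -[in LHS](_ : (s %/ 2 - 2 ^ i * d + s %/ 2 = (s %/ 2 - 2 ^ i.-1 * d) * 2)%N).
  by rewrite exprD !rmorphN /=; ring.
have E2i : (2 ^ i = 2 * 2 ^ i.-1)%N by rewrite -expnS prednK.
have L : (2 ^ i * d <= s %/ 2)%N.
  by rewrite Es2 leq_mul2r leq_exp2l // (ltnW im) orbT.
by move: L; rewrite E2i -mulnA; move: (2 ^ i.-1 * d)%N; clear; lia.
Qed.

(** Coordinates with respect to 1 and [sg], extracted from the Gauss sums of a character and of its
    inverse. This form also covers [r = m], where the coordinates are purely imaginary. *)
Definition xx r := (gs (2 ^ (m - r)) + gs (e.-1 * 2 ^ (m - r))) / 2.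
Definition yy r := (gs (2 ^ (m - r)) - gs (e.-1 * 2 ^ (m - r))) / (2 * sg).
(** The exponent is 1/2 - 1/2^(r-1): the Gauss sum has absolute value q^(1/2), and A_r + B_r
    sqrt(-2) has absolute value q^(1/2^(r-1)). *)
Definition rq r := qpow (p ^ s) (2 ^ (r - 2) - 1) (2 ^ (r - 1)).

Lemma sg_neq0 : sg != 0.
Proof.
apply/eqP => Z; have /eqP := sg_sqr.
by rewrite Z expr0n /= eq_sym oppr_eq0 pnatr_eq0.
Qed.

Lemma xx_yy_gs r : gs (2 ^ (m - r)) = xx r + yy r * sg.
Proof. by rewrite /xx /yy; field; rewrite ?sg_neq0 ?pnatr_eq0. Qed.

Lemma xx_yy_gs' r : gs (e.-1 * 2 ^ (m - r)) = xx r - yy r * sg.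
Proof. by rewrite /xx /yy; field; rewrite ?sg_neq0 ?pnatr_eq0. Qed.

Lemma xx_yy_eq r x y : gs (2 ^ (m - r)) = x + y * sg ->
  gs (e.-1 * 2 ^ (m - r)) = x - y * sg -> xx r = x /\ yy r = y.
Proof.
by rewrite /xx /yy => -> ->; split; field; rewrite ?sg_neq0 ?pnatr_eq0.
Qed.

Lemma qpowE a b (y : algC) : (0 < b)%N -> 0 <= y ->
  y ^+ b = p%:R ^+ (s * a) -> qpow (p ^ s) a b = y.
Proof. by move=> b0 y0 E; rewrite /qpow -expnM natrX -E exprCK. Qed.

Lemma level_mid r : (3 <= r < m)%N ->
  yy r ^+ 2 = (B r)%:~R ^+ 2 * rq r ^+ 2 /\ xx r = (A r)%:~R * rq r.
Proof.
move=> rm; have [c [d [_ [_ [Es od _ _ _]]]]] := top_value.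
have im : (1 <= m - r <= m - 3)%N by move: rm; clear; lia.
have [b [Eb Eg]] := level_lower Es od im.
have Er : (m - (m - r) = r)%N by move: rm; clear; lia.
rewrite Er in Eb Eg; set i := (m - r)%N in im Eg *.
have Eq : rq r = p%:R ^+ (s %/ 2 - 2 ^ i.-1 * d).
  apply: qpowE; rewrite ?expn_gt0 ?exprn_ge0 ?ler0n // -exprM; congr (_ ^+ _).
  have E1 : (2 ^ (r - 1) = 2 * 2 ^ (r - 2))%N.
    by rewrite -expnS; congr expn; move: rm; clear; lia.
  have E2 : (2 ^ i.-1 * d * (2 * 2 ^ (r - 2)) = s)%N.
    rewrite -E1 Es mulnAC -expnD -expnS; congr (2 ^ _ * _)%N.
    by move: rm; rewrite /i; clear; lia.
  rewrite E1 mulnBl E2 mulnBr muln1 mulnA divnK // dvdn2; exact: s_even.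
have Egc : gs (e.-1 * 2 ^ i) = (gs (2 ^ i))^*.
  rewrite gs_conj ?expn_gt0 // -signr_odd oddX orbF.
  by rewrite gtn_eqF ?expr0 ?mul1r //; case/andP: im.
rewrite -Eq mulrDr mulrA in Eg.
have rqC : (rq r)^* = rq r by rewrite Eq rmorphXn rmorph_nat.
have [|Ex Ey] := xx_yy_eq Eg (r := r).
  by rewrite Egc Eg rmorphD !rmorphM /= !rmorph_int sg_conj rqC mulrN.
rewrite Ex Ey; split; last by rewrite mulrC.
by rewrite exprMn mulrC -!rmorphXn Eb.
Qed.

(** Here [gs 1] is K (a + b [sg]) with K a rational multiple of [gp], hence purely imaginary. Only
    squares are claimed, as the signs of [gp], [a] and [b] are not known. *)
Lemma level_top :
  yy m ^+ 2 = (B m)%:~R ^+ 2 * (rq m * 'i) ^+ 2 /\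
  xx m ^+ 2 = (A m)%:~R ^+ 2 * (rq m * 'i) ^+ 2.
Proof.
have [c [d [a [b [Es od Ecd [Eab na] Egs]]]]] := top_value.
have d0 : (0 < d)%N by case: d od {Es Ecd Eab}.
have mm : (2 <= m <= m)%N by rewrite leqnn andbT ltnW.
have E2M : (2 ^ (m - 2) = 2 * M)%N by rewrite -expnS; congr expn; move: m3; clear; lia.
have Er : (s %/ 2 ^ (m - 2) = d)%N by rewrite E2M Es mulKn // muln_gt0 M_gt0.
have FV := @form_value m a b mm; rewrite Er in FV.
have [Ea Eb _] := FV d0 Eab na.
have L : (d <= s)%N by rewrite Es leq_pmull // muln_gt0 M_gt0.
have Eq : rq m = sqrtC (p%:R ^+ (s - d)).
  apply: qpowE; rewrite ?expn_gt0 ?sqrtC_ge0 ?exprn_ge0 ?ler0n //.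
  have -> : (2 ^ (m - 1) = 2 * 2 ^ (m - 2))%N.
    by rewrite -expnS; congr expn; move: m3; clear; lia.
  rewrite exprM sqrtCK -exprM; congr (_ ^+ _).
  by rewrite mulnBl mulnBr muln1 E2M [(d * _)%N]mulnC -Es.
have Eq2 : (rq m * 'i) ^+ 2 = - p%:R ^+ (s - d).
  by rewrite exprMn sqrCi Eq sqrtCK mulrN1.
have Ec2 : ((c * 2) = (s - d).+1)%N by move: Ecd L; clear; lia.
pose K := - (p%:R^-1 * gp * p%:R ^+ c).
have EK2 : K ^+ 2 = - p%:R ^+ (s - d).
  rewrite sqrrN !exprMn gp_sqr -exprM Ec2 [p%:R ^+ (s - d).+1]exprS.
  by move: (p%:R ^+ (s - d)) p_neq0 => T n0; field.
have E1 : gs 1 = K * a%:~R + K * b%:~R * sg.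
  have -> : gs 1 = - (p%:R^-1 * gp * (gp * gs 1)).
    have -> : p%:R^-1 * gp * (gp * gs 1) = p%:R^-1 * (gp ^+ 2 * gs 1) by ring.
    by rewrite gp_sqr mulrA mulrN mulVf ?p_neq0 // mulN1r opprK.
  by rewrite Egs /K; ring.
have KC : K^* = - K.
  by rewrite /K rmorphN !rmorphM rmorphXn fmorphV /= rmorph_nat gp_conj; ring.
have E1' : gs (e.-1 * 1) = K * a%:~R - K * b%:~R * sg.
  have := gs_conj (k := 1) isT; rewrite expr1 mulN1r => E.
  rewrite -[LHS]opprK -E E1 rmorphD !rmorphM /= !rmorph_int sg_conj KC; ring.
have [||Ex Ey] := @xx_yy_eq m (K * a%:~R) (K * b%:~R); rewrite ?subnn ?expn0 //.
rewrite Ex Ey Eq2 !exprMn EK2 -!rmorphXn Ea Eb.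
by split; rewrite mulrC.
Qed.

(** * Periods and the number of solutions *)

(** The value of the sum of psi(y x^e) at [t] the conjugate of [chi y]. The trivial character
    [k = 0] contributes the full sum of [psi], which is 0. *)
Definition period (t : algC) := \sum_(k < e) (if k == 0%N :> nat then 0 else t ^+ k * gs k).

Lemma period_char y : y != 0 -> \sum_x psi (y * x ^+ e) = period (z^* ^+ ind g y).
Proof.
move=> y0; rewrite (sum_psi_pow y dvq Hz) -/chi.
under eq_bigr do rewrite mulr_suml.
rewrite exchange_big; apply: eq_bigr => k _ /=.
have [k0|k0] := posnP k.
  rewrite k0; under eq_bigr do rewrite expr0 mul1r mulrC.
  by rewrite (sum_add_char y apsi npsi) (negPf y0).
rewrite (gauss_twist _ (mchiX k0) y0); congr (_ * _).
rewrite /chi /pow_char (negPf y0) !rmorphXn; congr (_ ^+ _).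
Qed.

Lemma card_solutions n : (q * nsol F n e)%:R =
  (q ^ n)%:R + \sum_(y | y != 0) period (z^* ^+ ind g y) ^+ n.
Proof.
have [p0 pD _] := apsi.
have psum y (x : 'rV[F]_n) : psi (y * \sum_(i < n) x ord0 i ^+ e) =
    \prod_(i < n) psi (y * x ord0 i ^+ e).
  rewrite mulr_sumr; elim/big_ind2: _ => //.
  by move=> x1 x2 y1 y2 <- <-; rewrite pD.
transitivity (\sum_(y : F) \sum_(x : 'rV[F]_n) psi (y * \sum_(i < n) x ord0 i ^+ e)).
  rewrite exchange_big /= natrM /nsol.
  under eq_bigr do rewrite (sum_add_char _ apsi npsi).
  rewrite -big_mkcond sumr_const -[RHS]mulr_natr; congr (_ * _%:R).
  by apply: eq_card => x; rewrite !inE.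
have Ey y : \sum_(x : 'rV[F]_n) psi (y * \sum_(i < n) x ord0 i ^+ e) =
    (\sum_x psi (y * x ^+ e)) ^+ n.
  under eq_bigr do rewrite psum.
  rewrite -[in RHS](card_ord n) -prodr_const bigA_distr_bigA /=.
  rewrite (reindex (fun f : {ffun 'I_n -> F} => \row_i f i)) /=.
    by apply: eq_bigr => f _; apply: eq_bigr => i _; rewrite mxE.
  exists (fun x : 'rV[F]_n => [ffun i => x ord0 i]) => [f _|x _].
    by apply/ffunP => i; rewrite ffunE mxE.
  by apply/rowP => i; rewrite mxE ffunE.
rewrite (bigD1 0) //=; congr (_ + _).
  rewrite Ey; under eq_bigr do rewrite mul0r p0.
  by rewrite sumr_const natrX.
by apply: eq_bigr => y y0; rewrite Ey period_char.
Qed.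

Lemma card_solutions_periods n : (0 < n)%N ->
  (nsol F n e)%:R = (q ^ n.-1)%:R +
  q.-1%:R / (e * q)%:R * \sum_(j < e) period (z^* ^+ j) ^+ n.
Proof.
move=> n0.
have q0 : q%:R != 0 :> algC by rewrite pnatr_eq0 eqn0Ngt (ltnW q_gt1).
have e0 : e%:R != 0 :> algC by rewrite pnatr_eq0 expn_eq0.
have we : z^* ^+ e = 1 by rewrite -rmorphXn (prim_expr_order Hz) rmorph1.
have E := sum_index Hg (fun t => period t ^+ n) we dvq.
apply: (mulfI q0); rewrite -natrM card_solutions mulrDr; congr (_ + _).
  by rewrite -natrM -expnS prednK.
apply: (mulfI e0); rewrite E natrM.
move: (\sum_(j < e) _) (q.-1%:R) => S Q.
by move: (q%:R) (e%:R) q0 e0 => a b a0 b0; field; rewrite a0 b0.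
Qed.

(** * Contribution to a period of the characters of each order *)

Definition level r (t : algC) := \sum_(i < 2 ^ (r - 1))
  t ^+ (2 ^ (m - r) * i.*2.+1) * gs (2 ^ (m - r) * i.*2.+1).

Lemma period_levels t : period t = \sum_(1 <= r < m.+1) level r t.
Proof.
rewrite /period (@sum_dyadic _ (fun k => if k == 0%N then 0 else t ^+ k * gs k)).
rewrite eqxx add0r big_add1 big_mkord (reindex_inj rev_ord_inj) /=.
apply: eq_bigr => r _; rewrite /level subn1 /=.
have -> : (m - (m - r.+1).+1 = r)%N by have := ltn_ord r; clear; lia.
by apply: eq_bigr => i _; rewrite muln_eq0 expn_eq0.
Qed.

Lemma level1 t : level 1 t = t ^+ h * gs h.
Proof. by rewrite /level subnn big_ord1 muln1 subn1. Qed.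

Lemma level2 t : level 2 t = (t ^+ (2 * M) + t ^+ (3 * (2 * M))) * gs (2 * M).
Proof.
have E : (2 ^ (m - 2) = 2 * M)%N by rewrite -expnS; congr expn; move: m3; clear; lia.
have E3 : gs (3 * (2 * M)) = gs (2 * M).
  by apply: gs_class; [right | rewrite muln_gt0 M_gt0].
rewrite /level E big_ord_recl big_ord1 /= muln1 [(2 * M * _)%N]mulnC.
by rewrite -[(_.*2.+1 * _)%N]/(3 * (2 * M))%N E3 mulrDl.
Qed.

(** The odd multipliers are grouped in fours, 8a + 1, 8a + 3, 8a + 5, 8a + 7: the first two share
    one Gauss sum, the last two that of the inverse character, and summation over [a] is geometric
    in [W ^+ 8]. *)
Lemma level_ge3 r t : (3 <= r <= m)%N -> t ^+ e = 1 ->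
  let W := t ^+ (2 ^ (m - r)) in
  level r t = (if W ^+ 8 == 1 then (2 ^ (r - 3))%:R else 0) *
    ((W + W ^+ 3) * (gs (2 ^ (m - r)) + W ^+ 4 * gs (e.-1 * 2 ^ (m - r)))).
Proof.
move=> rm te W.
have k0 : (0 < 2 ^ (m - r))%N by rewrite expn_gt0.
rewrite /level; have -> : (2 ^ (r - 1) = 2 ^ (r - 3) * 4)%N.
  by rewrite -(expnD 2 _ 2); congr expn; move: rm; clear; lia.
rewrite (@sum_blocks _ (fun i => t ^+ (2 ^ (m - r) * i.*2.+1) * gs (2 ^ (m - r) * i.*2.+1))).
rewrite -(@sum_geometric_unity _ (W ^+ 8)); last first.
  rewrite -exprM /W -exprM (_ : (2 ^ (m - r) * (8 * 2 ^ (r - 3)) = e)%N) //.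
  by rewrite -(expnD 2 3) -expnD; congr expn; move: rm; clear; lia.
rewrite mulr_suml; apply: eq_bigr => a _.
rewrite !big_ord_recl big_ord0 /= /bump /=.
have tW k c : k.*2.+1 = c -> t ^+ (2 ^ (m - r) * k.*2.+1) = W ^+ c.
  by move=> ->; rewrite exprM.
have cl k c : k.*2.+1 = c -> (c %% 8 = 1)%N \/ (c %% 8 = 3)%N ->
    gs (2 ^ (m - r) * k.*2.+1) = gs (2 ^ (m - r)).
  by move=> -> Hc; rewrite mulnC gs_class.
have cln k c : k.*2.+1 = c -> (c %% 8 = 5)%N \/ (c %% 8 = 7)%N ->
    gs (2 ^ (m - r) * k.*2.+1) = gs (e.-1 * 2 ^ (m - r)).
  by move=> -> Hc; rewrite mulnC gs_class_neg.
have i0 : ((a * 4 + 0).*2.+1 = 8 * a + 1)%N by clear; lia.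
have i1 : ((a * 4 + (1 + 0)).*2.+1 = 8 * a + 3)%N by clear; lia.
have i2 : ((a * 4 + (1 + (1 + 0))).*2.+1 = 8 * a + 5)%N by clear; lia.
have i3 : ((a * 4 + (1 + (1 + (1 + 0)))).*2.+1 = 8 * a + 7)%N by clear; lia.
rewrite (tW _ _ i0) (tW _ _ i1) (tW _ _ i2) (tW _ _ i3).
rewrite (cl _ _ i0); last by left; clear; lia.
rewrite (cl _ _ i1); last by right; clear; lia.
rewrite (cln _ _ i2); last by left; clear; lia.
rewrite (cln _ _ i3); last by right; clear; lia.
have X c : W ^+ (8 * a + c) = (W ^+ 8) ^+ a * W ^+ c by rewrite exprD exprM.
rewrite !X; clearbody W; move: ((W ^+ 8) ^+ a) => Y; ring.
Qed.

Lemma level_z8 r t u : (3 <= r <= m)%N -> t ^+ e = 1 ->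
  t ^+ (2 ^ (m - r)) = z8 ^+ u ->
  level r t = (2 ^ (r - 3))%:R * ((z8 ^+ u + z8 ^+ (3 * u)) *
    (xx r + yy r * sg + (-1) ^+ u * (xx r - yy r * sg))).
Proof.
move=> rm te E; rewrite level_ge3 // E -xx_yy_gs -xx_yy_gs'.
have -> : (z8 ^+ u) ^+ 8 = 1 by rewrite exprAC (prim_expr_order prim_z8) expr1n.
rewrite eqxx; congr (_ * ((_ + _) * (_ + _ * _))).
  by rewrite -exprM mulnC.
by rewrite exprAC z8_4.
Qed.

(* [2 ^ (r - 1) * coef v l r] is the contribution of the characters of order
   [2 ^ r] to the period of index [2 ^ v * (2 * l + 1)]. *)
Definition coef v l r : algC :=
  if (v + 3 < r)%N then 0 else
  if (v + 3 == r)%N then (if (l %% 4 < 2)%N then yy r else - yy r) else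
  if (v + 2 == r)%N then 0 else
  if (v + 1 == r)%N then - xx r else xx r.

Lemma w_e k : (z^* ^+ k) ^+ e = 1.
Proof.
have we : z^* ^+ e = 1 by rewrite -rmorphXn (prim_expr_order Hz) rmorph1.
by rewrite exprAC we expr1n.
Qed.

Lemma w_M k : z^* ^+ (M * k) = z8 ^+ (7 * k).
Proof.
have wM : z^* ^+ M = z8^* by rewrite -rmorphXn.
by rewrite exprM wM -z8_conj [RHS]rmorphXn.
Qed.

Lemma two_pow_pred r : (3 <= r)%N -> (2 ^ (r - 1) = 4 * 2 ^ (r - 3))%N.
Proof. by move=> r3; rewrite -(expnD 2 2); congr expn; lia. Qed.

(** The exponent u = 7 * 2^(v+3-r) (2l+1) of [z8] decides, the 7 coming from conjugation. If u is
    odd the [xx] parts cancel; if u is 2 modulo 4 the orbit sum is 0; if u is 4 or 0 modulo 8 the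
    [yy] parts cancel and the orbit sum is -2 or 2. *)
Lemma level_coef v l r : (3 <= r <= m)%N ->
  level r (z^* ^+ (2 ^ v * l.*2.+1)) = (2 ^ (r - 1))%:R * coef v l r.
Proof.
move=> rm; rewrite /coef; have r3 : (3 <= r)%N by case/andP: rm.
have [vr|rv] := ltnP.
  rewrite mulr0 level_ge3 ?w_e //.
  suff /negPf -> : ((z^* ^+ (2 ^ v * l.*2.+1)) ^+ (2 ^ (m - r))) ^+ 8 != 1.
    by rewrite mul0r.
  have -> : ((z^* ^+ (2 ^ v * l.*2.+1)) ^+ (2 ^ (m - r))) ^+ 8 =
      (z ^+ (2 ^ v * l.*2.+1 * 2 ^ (m - r) * 8))^* by rewrite !exprM !rmorphXn.
  rewrite fmorph_eq1 -(prim_order_dvd Hz).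
  have -> : (2 ^ v * l.*2.+1 * 2 ^ (m - r) * 8 = 2 ^ (v + (m - r) + 3) * l.*2.+1)%N.
    by rewrite !expnD; move: (2 ^ v)%N (2 ^ (m - r))%N; clear => *; lia.
  rewrite Gauss_dvdl; last by rewrite coprimeXl // coprime2n /= odd_double.
  by rewrite dvdn_Pexp2l // -ltnNge; move: rm vr; clear; lia.
have EW : (z^* ^+ (2 ^ v * l.*2.+1)) ^+ (2 ^ (m - r)) =
    z8 ^+ (7 * (2 ^ (v + 3 - r) * l.*2.+1)).
  rewrite -w_M -exprM; congr (_ ^+ _).
  rewrite mulnAC mulnA -!expnD; congr (2 ^ _ * _)%N.
  by move: rm rv; clear; lia.
rewrite (level_z8 rm (w_e _) EW) z8_theta two_pow_pred // natrM -mulrA.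
rewrite -signr_odd [X in _ = X]mulrCA; congr (_ * _).
have s2 := sg_sqr.
have dY : 2 * yy r * sg ^+ 2 = - (4 * yy r) by rewrite s2; ring.
case: eqP => [vr|nvr].
  have -> : (v + 3 - r = 0)%N by rewrite vr subnn.
  have -> : odd (7 * (2 ^ 0 * l.*2.+1)) by clear; lia.
  have : (l %% 4 = 0 \/ l %% 4 = 1 \/ l %% 4 = 2 \/ l %% 4 = 3)%N by clear; lia.
  case=> [|[|[|]]] Hl; rewrite Hl /= expr1.
  - have -> : (7 * (2 ^ 0 * l.*2.+1) %% 8 = 7)%N by move: Hl; clear; lia.
    by rewrite /= -[RHS]opprK -dY; ring.
  - have -> : (7 * (2 ^ 0 * l.*2.+1) %% 8 = 5)%N by move: Hl; clear; lia.
    by rewrite /= -[RHS]opprK -dY; ring.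
  - have -> : (7 * (2 ^ 0 * l.*2.+1) %% 8 = 3)%N by move: Hl; clear; lia.
    by rewrite /= mulrN -dY; ring.
  - have -> : (7 * (2 ^ 0 * l.*2.+1) %% 8 = 1)%N by move: Hl; clear; lia.
    by rewrite /= mulrN -dY; ring.
case: eqP => [vr|nvr2].
  have -> : (v + 3 - r = 1)%N by move: vr; clear; lia.
  have : (7 * (2 ^ 1 * l.*2.+1) %% 8 = 2)%N \/ (7 * (2 ^ 1 * l.*2.+1) %% 8 = 6)%N.
    by clear; lia.
  by case=> -> /=; rewrite mul0r mulr0.
case: eqP => [vr|nvr3].
  have -> : (v + 3 - r = 2)%N by move: vr; clear; lia.
  have -> : (7 * (2 ^ 2 * l.*2.+1) %% 8 = 4)%N by clear; lia.
  have -> : odd (7 * (2 ^ 2 * l.*2.+1)) = false by clear; lia.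
  by rewrite /= expr0; ring.
have [k ->] : exists k, (v + 3 - r = 3 + k)%N.
  by exists (v - r)%N; move: rv nvr nvr2 nvr3; clear; lia.
have -> : (7 * (2 ^ (3 + k) * l.*2.+1) %% 8 = 0)%N.
  by rewrite expnD mulnCA -mulnA modnMr.
have -> : odd (7 * (2 ^ (3 + k) * l.*2.+1)) = false.
  by rewrite expnD !oddM.
by rewrite /= expr0; ring.
Qed.

(** The contribution of the characters of orders 2 and 4 to a period whose index has valuation
    [v]. *)
Definition base v := if v is v'.+1 then
  (if v' is _.+1 then gs h + 2 * gs (2 * M) else gs h - 2 * gs (2 * M)) else - gs h.

Lemma period_value v l : period (z^* ^+ (2 ^ v * l.*2.+1)) =
  base v + \sum_(3 <= r < m.+1) (2 ^ (r - 1))%:R * coef v l r.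
Proof.
rewrite period_levels (big_cat_nat (n := 3)) //=; last exact: ltnW.
congr (_ + _); last first.
  by apply: eq_big_nat => r rm; apply: level_coef; rewrite -ltnS.
rewrite big_ltn // big_nat1 level1 level2.
have -> : (z^* ^+ (2 ^ v * l.*2.+1)) ^+ h = (-1) ^+ (2 ^ v * l.*2.+1).
  have wh : z^* ^+ h = -1.
    have z28 : z8 ^+ (7 * 4) = -1 by rewrite mulnC exprM z8_4 -signr_odd expr1.
    by rewrite hM mulnC w_M z28.
  by rewrite exprAC wh.
rewrite -!exprM.
have E3 k : z^* ^+ (k * (2 * M)) + z^* ^+ (k * (3 * (2 * M))) =
    z8 ^+ (14 * k) + z8 ^+ (3 * (14 * k)).
  rewrite (_ : k * (2 * M) = M * (2 * k))%N; last by rewrite mulnC -mulnA mulnCA.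
  rewrite (_ : k * (3 * (2 * M)) = M * (6 * k))%N; last by clear; lia.
  by rewrite !w_M !mulnA.
rewrite E3 z8_theta -signr_odd oddM oddX /=.
case: v => [|[|v]] /=.
- rewrite odd_double expr1.
  have : (14 * (2 ^ 0 * l.*2.+1) %% 8 = 6)%N \/ (14 * (2 ^ 0 * l.*2.+1) %% 8 = 2)%N.
    by clear; lia.
  by case=> -> /=; rewrite mul0r addr0 mulN1r.
- have -> : (14 * (2 ^ 1 * l.*2.+1) %% 8 = 4)%N by clear; lia.
  by rewrite expr0 /=; ring.
have -> : (14 * (2 ^ v.+2 * l.*2.+1) %% 8 = 0)%N.
  rewrite !expnS; move: (2 ^ v)%N; clear => k.
  rewrite (_ : 14 * (2 * (2 * k) * l.*2.+1) = 7 * k * l.*2.+1 * 8)%N ?modnMl //.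
  by lia.
by rewrite expr0 /=; ring.
Qed.

Lemma period_value0 : period 1 =
  base 2 + \sum_(3 <= r < m.+1) (2 ^ (r - 1))%:R * xx r.
Proof.
rewrite period_levels (big_cat_nat (n := 3)) //=; last exact: ltnW.
congr (_ + _); last first.
  apply: eq_big_nat => r rm.
  rewrite (@level_z8 r 1 0) ?expr1n // two_pow_pred; last by case/andP: rm.
  by rewrite muln0 !expr0 natrM; ring.
by rewrite big_ltn // big_nat1 level1 level2 !expr1n; ring.
Qed.

(** The part of the period depending on the valuation [v] only. The guard is there because the
    special order r = v + 1 belongs to the range r >= 3 only for v >= 2. *)
Definition center v : algC := base v + \sum_(3 <= r < v.+1) (2 ^ (r - 1))%:R * xx r
  - (if (v < 2)%N then 0 else (2 ^ v)%:R * xx v.+1).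

(** The upper bound is kept free for induction; the conditions record whether the special orders v +
    1 and v + 3 are in range. *)
Lemma sum_coef v l K : \sum_(3 <= r < 3 + K) (2 ^ (r - 1))%:R * coef v l r =
  \sum_(3 <= r < 3 + K | (r < v.+1)%N) (2 ^ (r - 1))%:R * xx r
  - (if (2 <= v < 2 + K)%N then (2 ^ v)%:R * xx v.+1 else 0)
  + (if (v < K)%N then (2 ^ (v + 2))%:R *
       (if (l %% 4 < 2)%N then yy (v + 3) else - yy (v + 3)) else 0).
Proof.
elim: K => [|K IH].
  by rewrite !big_geq // ltn0 addn0 (_ : (2 <= v < 2)%N = false) ?subrr ?addr0 //; lia.
rewrite addnS big_nat_recr ?leq_addr // IH /= [in RHS]big_mkcond big_nat_recr ?leq_addr //=.
rewrite -big_mkcond (addnS 2 K) /coef.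
set S := \sum_(3 <= r < 3 + K | _) _.
case: (ltngtP (v + 3) (3 + K)) => vK.
- have -> : (3 + K < v.+1)%N = false by move: vK; clear; lia.
  have -> : (v < K)%N by move: vK; clear; lia.
  have -> : (v < K.+1)%N by move: vK; clear; lia.
  have -> : (v < 2 + K)%N by move: vK; clear; lia.
  have -> : (v < (2 + K).+1)%N by move: vK; clear; lia.
  by rewrite mulr0 !addr0.
- have -> : (v < K)%N = false by move: vK; clear; lia.
  have -> : (v < K.+1)%N = false by move: vK; clear; lia.
  case: eqP => [v2|nv2].
    have -> : (3 + K < v.+1)%N = false by move: v2; clear; lia.
    have -> : (v < 2 + K)%N by move: v2; clear; lia.
    have -> : (v < (2 + K).+1)%N by move: v2; clear; lia.
    by rewrite mulr0 !addr0.
  case: eqP => [v1|nv1].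
    have -> : (3 + K < v.+1)%N = false by move: v1; clear; lia.
    have -> : (v < 2 + K)%N = false by move: v1; clear; lia.
    have -> : (v < (2 + K).+1)%N by move: v1; clear; lia.
    have -> : (2 <= v)%N by move: v1; clear; lia.
    rewrite /= !addr0 subr0 -v1 addn1 mulrN.
    by rewrite (_ : v.+1 - 1 = v)%N // subn1.
  have -> : (3 + K < v.+1)%N by move: vK nv2 nv1; clear; lia.
  have -> : (v < 2 + K)%N = false by move: vK nv2 nv1; clear; lia.
  have -> : (v < (2 + K).+1)%N = false by move: vK nv2 nv1; clear; lia.
  by rewrite andbF !subr0 !addr0.
have -> : (3 + K < v.+1)%N = false by move: vK; clear; lia.
have -> : (v < K)%N = false by move: vK; clear; lia.
have -> : (v < K.+1)%N by move: vK; clear; lia.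
have -> : (v < 2 + K)%N by move: vK; clear; lia.
have -> : (v < (2 + K).+1)%N by move: vK; clear; lia.
rewrite !addr0 -vK; congr (_ + _%:R * _).
by congr (2 ^ _)%N; clear; lia.
Qed.

Lemma period_center v l : (v < m)%N -> period (z^* ^+ (2 ^ v * l.*2.+1)) =
  center v + (if (v < m - 2)%N then (2 ^ (v + 2))%:R *
       (if (l %% 4 < 2)%N then yy (v + 3) else - yy (v + 3)) else 0).
Proof.
move=> vm; rewrite period_value.
have Em : (m.+1 = 3 + (m - 2))%N by move: m3; clear; lia.
rewrite Em sum_coef !addrA; congr (_ + _).
rewrite /center (big_nat_widen 3 v.+1 (3 + (m - 2))); last by rewrite -Em leqW.
congr (_ + _ - _).
have -> : (v < 2 + (m - 2))%N by move: vm m3; clear; lia.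
by rewrite andbT; case: (v) => [|[|?]].
Qed.

(** * The power sum of the periods and the three formulas *)

Definition pair n c d : algC := (c + d) ^+ n + (c - d) ^+ n.

(** Indices are grouped by valuation [v]. Below m - 2 the two signs of [yy] are equally frequent; at
    m - 2 two equal periods remain; the single index of valuation m - 1 pairs with the index 0, the
    two differing in the sign of [xx m]. *)
Lemma sum_periods n : \sum_(j < e) period (z^* ^+ j) ^+ n =
  \sum_(0 <= v < m - 2) (2 ^ (m - v - 2))%:R *
     pair n (center v) ((2 ^ (v + 2))%:R * yy (v + 3))
  + 2 * center (m - 2) ^+ n
  + pair n (base 2 + \sum_(3 <= r < m) (2 ^ (r - 1))%:R * xx r)
      ((2 ^ (m - 1))%:R * xx m).
Proof.
have Em : m = (m - 2).+2 by move: m3; clear; lia.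
have spl (f : nat -> algC) :
    \sum_(0 <= v < m) f v = \sum_(0 <= v < m - 2) f v + f (m - 2)%N + f (m - 2).+1.
  by rewrite [in LHS]Em !big_nat_recr.
rewrite (@sum_dyadic _ (fun j => period (z^* ^+ j) ^+ n)) expr0 period_value0.
rewrite -(big_mkord xpredT (fun v => \sum_(i < 2 ^ (m - v.+1)) period (z^* ^+ (2 ^ v * i.*2.+1)) ^+ n)).
rewrite spl big_nat_recr //= [in X in X ^+ n]addrA -/(base 2).
set D := base 2 + _.
have -> : \sum_(0 <= v < m - 2) \sum_(i < 2 ^ (m - v.+1)) period (z^* ^+ (2 ^ v * i.*2.+1)) ^+ n =
  \sum_(0 <= v < m - 2) (2 ^ (m - v - 2))%:R *
     pair n (center v) ((2 ^ (v + 2))%:R * yy (v + 3)).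
  apply: eq_big_nat => v /= vm.
  have vm' : (v < m)%N by move: vm; clear; lia.
  (* The sign of [yy] depends on [l] modulo 4, so each block of four indices gives two pairs. *)
  have -> : (2 ^ (m - v.+1) = 2 ^ (m - v - 3) * 4)%N.
    by rewrite -(expnD 2 _ 2); congr expn; move: vm; clear; lia.
  rewrite (@sum_blocks _ (fun i => period (z^* ^+ (2 ^ v * i.*2.+1)) ^+ n)).
  rewrite (eq_bigr (fun=> 2 * pair n (center v) ((2 ^ (v + 2))%:R * yy (v + 3)))).
    rewrite sumr_const card_ord -[_ *+ _]mulr_natl mulrA -natrM.
    by congr (_%:R * _); rewrite mulnC -expnS; congr expn; move: vm; clear; lia.
  move=> a _; rewrite !big_ord_recl big_ord0 /= !period_center // vm.
  rewrite !modnMDl /= /bump /= /pair !mulrN.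
  by move: ((_ + _) ^+ n) ((_ - _) ^+ n) => X Y; ring.
have -> : \sum_(i < 2 ^ (m - (m - 2).+1)) period (z^* ^+ (2 ^ (m - 2) * i.*2.+1)) ^+ n =
    2 * center (m - 2) ^+ n.
  have -> : (m - (m - 2).+1 = 1)%N by move: m3; clear; lia.
  rewrite big_ord_recl big_ord1 !period_center ?ltnn; try by move: m3; clear; lia.
  by rewrite !addr0; ring.
have -> : \sum_(i < 2 ^ (m - (m - 2).+2)) period (z^* ^+ (2 ^ (m - 2).+1 * i.*2.+1)) ^+ n =
    (D - (2 ^ (m - 1))%:R * xx m) ^+ n.
  have -> : (m - (m - 2).+2 = 0)%N by move: m3; clear; lia.
  rewrite big_ord1 period_center; last by move: m3; clear; lia.
  have -> : ((m - 2).+1 < m - 2)%N = false by clear; lia.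
  rewrite addr0 /center.
  have -> : ((m - 2).+1 < 2)%N = false by move: m3; clear; lia.
  have -> : (m - 1 = (m - 2).+1)%N by move: m3; clear; lia.
  rewrite -Em; congr ((_ + _ - _) ^+ _).
  by rewrite /base; have -> : (m - 2 = (m - 3).+1)%N by move: m3; clear; lia.
rewrite /pair; move: (\sum_(0 <= v < m - 2) _) (2 * _) => S C.
by move: ((_ + _) ^+ n) ((_ - _) ^+ n) => X Y; ring.
Qed.

Local Notation Q := (qpow (p ^ s) 1 2).
Local Notation a r := ((A r)%:~R : algC).
Local Notation b r := ((B r)%:~R : algC).

Lemma Q_value : Q = (p ^ (s %/ 2))%:R.
Proof.
apply: qpowE; rewrite ?ler0n // -natrX -expnM divnK ?muln1 ?natrX //.
by rewrite dvdn2 s_even.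
Qed.

Lemma gs_h_Q : gs h = (if m == 3 then 1 else -1) * Q.
Proof. by rewrite gs_h_sign Q_value. Qed.

Lemma gs_quarter_Q : gs (2 * M) = - Q.
Proof.
by rewrite gs_quarter_value gs_h_Q -signr_odd odd_M; case: (m == 3); rewrite /=; ring.
Qed.

Lemma base_value v : base v =
  if m == 3 then (if v is v'.+1 then (if v' is _.+1 then - Q else 3 * Q) else - Q)
  else (if v is v'.+1 then (if v' is _.+1 then -3 * Q else Q) else Q).
Proof.
rewrite /base gs_quarter_Q gs_h_Q.
by case: v => [|[|v]]; case: (m == 3); ring.
Qed.

Lemma center_low v : (v < 2)%N -> center v = base v.
Proof.
by move=> v2; rewrite /center v2 subr0 big_geq ?addr0 // ltnS ltnW.
Qed.

Lemma sum_xx t : (t < m)%N -> \sum_(3 <= r < t.+1) (2 ^ (r - 1))%:R * xx r =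
  \sum_(3 <= r < t.+1) (2 ^ (r - 1))%:R * a r * rq r.
Proof.
move=> tm; apply: eq_big_nat => r /andP [r3 rt].
have [|_ ->] := @level_mid r; last by rewrite mulrA.
by rewrite r3 (leq_trans rt).
Qed.

Lemma center_high v : (2 <= v)%N -> (v <= m - 2)%N -> center v =
  base 2 + \sum_(3 <= r < v.+1) (2 ^ (r - 1))%:R * a r * rq r
  - (2 ^ v)%:R * a v.+1 * rq v.+1.
Proof.
move=> v2 vm.
have vm' : (v.+1 < m)%N by move: vm m3; clear; lia.
have [|_ Ex] := @level_mid v.+1; first by rewrite vm' andbT.
rewrite /center sum_xx; last exact: ltnW.
rewrite ltnNge v2 /= Ex mulrA; congr (_ + _ - _).
by case: v v2 {vm vm' Ex} => [|[]].
Qed.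

Lemma pair_sqr n c x y : x ^+ 2 = y ^+ 2 -> pair n c x = pair n c y.
Proof. exact: eq_sqr_pair. Qed.

(** The valuation m - 3 is split off because it involves the characters of top order, whose
    coordinates carry the factor i. *)
Lemma sum_periods_form n : \sum_(j < e) period (z^* ^+ j) ^+ n =
  \sum_(0 <= v < m - 3) (2 ^ (m - v - 2))%:R *
     pair n (center v) ((2 ^ (v + 2))%:R * b (v + 3)%N * rq (v + 3))
  + 2 * pair n (center (m - 3)) ((2 ^ (m - 1))%:R * b m * rq m * 'i)
  + 2 * center (m - 2) ^+ n
  + pair n (base 2 + \sum_(3 <= r < m) (2 ^ (r - 1))%:R * a r * rq r)
      ((2 ^ (m - 1))%:R * a m * rq m * 'i).
Proof.
have [Ey Ex] := level_top.
rewrite sum_periods; have -> : (m - 2 = (m - 3).+1)%N by move: m3; clear; lia.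
rewrite big_nat_recr //=; congr (_ + _ + _ + _).
- apply: eq_big_nat => v vm; congr (_ * _); apply: pair_sqr.
  have [|Ev _] := @level_mid (v + 3); first by move: vm; clear; lia.
  by rewrite exprMn Ev !exprMn mulrA.
- have -> : (m - (m - 3) - 2 = 1)%N by move: m3; clear; lia.
  rewrite expn1; congr (_ * _); apply: pair_sqr.
  have -> : (m - 3 + 3 = m)%N by move: m3; clear; lia.
  have -> : (m - 3 + 2 = m - 1)%N by move: m3; clear; lia.
  by rewrite exprMn Ey !exprMn; ring.
have Em : m = (m - 1).+1 by move: m3; clear; lia.
rewrite (_ : \sum_(3 <= r < m) (2 ^ (r - 1))%:R * xx r =
    \sum_(3 <= r < m) (2 ^ (r - 1))%:R * a r * rq r).
  by apply: pair_sqr; rewrite exprMn Ex !exprMn; ring.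
by rewrite Em sum_xx // -Em; move: m3; clear; lia.
Qed.

Lemma rq_eq r i j : (r - 2 = i)%N -> (r - 1 = j)%N ->
  rq r = qpow (p ^ s) (2 ^ i - 1) (2 ^ j).
Proof. by move=> <- <-. Qed.

Lemma count_m3 n : (0 < n)%N -> m = 3%N ->
  (nsol F n e)%:R = ((p ^ s) ^ n.-1)%:R + (p ^ s).-1%:R / (8 * p ^ s)%:R *
     (2 * ((- Q + 4 * b 3 * qpow (p ^ s) 1 4 * 'i) ^+ n
           + (- Q - 4 * b 3 * qpow (p ^ s) 1 4 * 'i) ^+ n)
      + 2 * (3 ^ n)%:R * qpow (p ^ s) n 2
      + (- Q + 4 * a 3 * qpow (p ^ s) 1 4 * 'i) ^+ n
      + (- Q - 4 * a 3 * qpow (p ^ s) 1 4 * 'i) ^+ n).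
Proof.
move=> n0 Em; rewrite card_solutions_periods // sum_periods_form cardF Em.
congr (_ + _ * _); rewrite [in X in X + _]big_geq // add0r.
rewrite !center_low // !base_value Em eqxx /= big_geq // addr0.
have -> : qpow (p ^ s) n 2 = Q ^+ n.
  apply: qpowE; rewrite ?exprn_ge0 ?Q_value ?ler0n //.
  rewrite exprAC -natrX -expnM divnK ?dvdn2 ?s_even // natrX exprM.
  by [].
rewrite (rq_eq (r := 3) (i := 1) (j := 2)) //.
by rewrite /pair exprMn -natrX mulrA addrA.
Qed.

Lemma count_m4 n : (0 < n)%N -> m = 4%N ->
  (nsol F n e)%:R = ((p ^ s) ^ n.-1)%:R + (p ^ s).-1%:R / (16 * p ^ s)%:R *
     (4 * ((Q + 4 * b 3 * qpow (p ^ s) 1 4) ^+ n + (Q - 4 * b 3 * qpow (p ^ s) 1 4) ^+ n)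
      + 2 * ((Q + 8 * b 4 * qpow (p ^ s) 3 8 * 'i) ^+ n
             + (Q - 8 * b 4 * qpow (p ^ s) 3 8 * 'i) ^+ n)
      + 2 * (- 3 * Q - 4 * a 3 * qpow (p ^ s) 1 4) ^+ n
      + (- 3 * Q + 4 * a 3 * qpow (p ^ s) 1 4 + 8 * a 4 * qpow (p ^ s) 3 8 * 'i) ^+ n
      + (- 3 * Q + 4 * a 3 * qpow (p ^ s) 1 4 - 8 * a 4 * qpow (p ^ s) 3 8 * 'i) ^+ n).
Proof.
move=> n0 Em; rewrite card_solutions_periods // sum_periods_form cardF.
rewrite [center (m - 2)]center_high; [|by rewrite Em|by []].
rewrite Em; congr (_ + _ * _); rewrite [in X in X + _ + _ + _]big_nat1.
rewrite !center_low // !base_value Em /= big_geq // addr0 big_nat1.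
rewrite (rq_eq (r := 3) (i := 1) (j := 2)) // (rq_eq (r := 4) (i := 2) (j := 3)) //.
by rewrite /pair addrA.
Qed.

Lemma count_ge5 n : (0 < n)%N -> (5 <= m)%N ->
  let S t := \sum_(3 <= r < t.+1) (2 ^ (r - 1))%:R * a r *
               qpow (p ^ s) (2 ^ (r - 2) - 1)%N (2 ^ (r - 1))%N in
  (nsol F n e)%:R = ((p ^ s) ^ n.-1)%:R + (p ^ s).-1%:R / (e * p ^ s)%:R *
     ((2 ^ (m - 2))%:R * ((Q + 4 * b 3 * qpow (p ^ s) 1 4) ^+ n
                          + (Q - 4 * b 3 * qpow (p ^ s) 1 4) ^+ n)
      + (2 ^ (m - 3))%:R * ((Q + 8 * b 4 * qpow (p ^ s) 3 8) ^+ n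
                          + (Q - 8 * b 4 * qpow (p ^ s) 3 8) ^+ n)
      + (\sum_(2 <= t < m - 3)
          (2 ^ (m - t - 2))%:R *
          ((- 3 * Q + S t
            - (2 ^ t)%:R * a t.+1 * qpow (p ^ s) (2 ^ (t - 1) - 1)%N (2 ^ t)%N
            + (2 ^ (t + 2))%:R * b (t + 3)%N * qpow (p ^ s) (2 ^ (t + 1) - 1)%N (2 ^ (t + 2))%N) ^+ n
         + (- 3 * Q + S t
            - (2 ^ t)%:R * a t.+1 * qpow (p ^ s) (2 ^ (t - 1) - 1)%N (2 ^ t)%N
            - (2 ^ (t + 2))%:R * b (t + 3)%N * qpow (p ^ s) (2 ^ (t + 1) - 1)%N (2 ^ (t + 2))%N) ^+ n))
      + 2 * ((- 3 * Q + S (m - 3)%N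
              - (2 ^ (m - 3))%:R * a (m - 2)%N * qpow (p ^ s) (2 ^ (m - 4) - 1)%N (2 ^ (m - 3))%N
              + (2 ^ (m - 1))%:R * b m * qpow (p ^ s) (2 ^ (m - 2) - 1)%N (2 ^ (m - 1))%N * 'i) ^+ n
           + (- 3 * Q + S (m - 3)%N
              - (2 ^ (m - 3))%:R * a (m - 2)%N * qpow (p ^ s) (2 ^ (m - 4) - 1)%N (2 ^ (m - 3))%N
              - (2 ^ (m - 1))%:R * b m * qpow (p ^ s) (2 ^ (m - 2) - 1)%N (2 ^ (m - 1))%N * 'i) ^+ n)
      + 2 * (- 3 * Q + S (m - 2)%N
             - (2 ^ (m - 2))%:R * a (m - 1)%N * qpow (p ^ s) (2 ^ (m - 3) - 1)%N (2 ^ (m - 2))%N) ^+ n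
      + (- 3 * Q + S (m - 1)%N
         + (2 ^ (m - 1))%:R * a m * qpow (p ^ s) (2 ^ (m - 2) - 1)%N (2 ^ (m - 1))%N * 'i) ^+ n
      + (- 3 * Q + S (m - 1)%N
         - (2 ^ (m - 1))%:R * a m * qpow (p ^ s) (2 ^ (m - 2) - 1)%N (2 ^ (m - 1))%N * 'i) ^+ n).
Proof.
move=> n0 m5 S; rewrite card_solutions_periods // sum_periods_form cardF.
have m_n3 : (m == 3) = false by apply/negbTE; move: m5; clear; lia.
have B2 : base 2 = -3 * Q by rewrite base_value m_n3.
have L t : (2 <= t)%N -> (t <= m - 2)%N -> center t = -3 * Q + S t
    - (2 ^ t)%:R * a t.+1 * qpow (p ^ s) (2 ^ (t - 1) - 1) (2 ^ t).
  move=> t2 tm; rewrite center_high // B2 (rq_eq (r := t.+1) (i := t - 1) (j := t)) //.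
  by rewrite subn1.
congr (_ + _ * _).
have [L3 L2] : (2 <= m - 3)%N /\ (2 <= m - 2)%N by move: m5; clear; lia.
have L32 : (m - 3 <= m - 2)%N by clear; lia.
rewrite (L _ L3 L32) (L _ L2 (leqnn _)) B2.
(* For the valuations 0 and 1 the center is just [base], namely [Q]; the general shape starts at
   2. *)
rewrite (big_ltn (m := 0)); last by move: L3; clear; lia.
rewrite (big_ltn (m := 1)); last by move: L3; clear; lia.
rewrite !center_low // !base_value m_n3 /=.
have -> : ((m - 3).+1 = m - 2)%N by move: m5; clear; lia.
have -> : ((m - 2).+1 = m - 1)%N by move: m5; clear; lia.
have -> : (m - 3 - 1 = m - 4)%N by clear; lia.
have -> : (m - 2 - 1 = m - 3)%N by clear; lia.
have ES : \sum_(3 <= r < m) (2 ^ (r - 1))%:R * a r * rq r = S (m - 1)%N.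
  by rewrite /S (_ : (m - 1).+1 = m) //; move: m5; clear; lia.
rewrite ES /pair subn0.
have -> : (m - 1 - 2 = m - 3)%N by clear; lia.
rewrite (rq_eq (r := 0 + 3) (i := 1) (j := 2)) // (rq_eq (r := 1 + 3) (i := 2) (j := 3)) //.
rewrite ![in LHS]addrA; congr (_ + _ + _ + _ + _ + _).
apply: eq_big_nat => t /andP [t2 tm].
rewrite L //; last by move: tm; clear; lia.
rewrite (rq_eq (r := t + 3) (i := t + 1) (j := t + 2)) //; by clear; lia.
Qed.

End GaussSums.

Unset Implicit Arguments.

Theorem theorem2 (p s q m n : nat) (F : finFieldType) (A B : nat -> int) :
  prime p -> (p %% 8 = 3)%N -> (1 <= s)%N -> q = (p ^ s)%N -> #|F| = q ->
  (3 <= m)%N -> (2 ^ m %| q.-1)%N -> ~~ (2 ^ m.+1 %| q.-1)%N -> (1 <= n)%N ->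
  (forall r, (2 <= r <= m)%N ->
     [/\ (p ^ (s %/ 2 ^ (r - 2)))%N%:Z = A r ^+ 2 + 2 * B r ^+ 2,
         (A r = -1 %[mod 4])%Z & ~~ (p%:Z %| A r)%Z]) ->
  let N := nsol F n (2 ^ m) in
  let Q := qpow q 1 2 in
  let Q4 := qpow q 1 4 in
  let Q38 := qpow q 3 8 in
  let a r : algC := (A r)%:~R in
  let b r : algC := (B r)%:~R in
  let Ssum t := \sum_(3 <= r < t.+1)
               (2 ^ (r - 1))%N%:R * a r * qpow q (2 ^ (r - 2) - 1)%N (2 ^ (r - 1))%N in
  ((m = 3)%N ->
   N%:R = (q ^ n.-1)%N%:R + (q.-1)%:R / (8 * q)%N%:R *
     (2 * ((- Q + 4 * b 3 * Q4 * 'i) ^+ n + (- Q - 4 * b 3 * Q4 * 'i) ^+ n)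
      + 2 * (3 ^ n)%N%:R * qpow q n 2
      + (- Q + 4 * a 3 * Q4 * 'i) ^+ n + (- Q - 4 * a 3 * Q4 * 'i) ^+ n))
  /\
  ((m = 4)%N ->
   N%:R = (q ^ n.-1)%N%:R + (q.-1)%:R / (16 * q)%N%:R *
     (4 * ((Q + 4 * b 3 * Q4) ^+ n + (Q - 4 * b 3 * Q4) ^+ n)
      + 2 * ((Q + 8 * b 4 * Q38 * 'i) ^+ n + (Q - 8 * b 4 * Q38 * 'i) ^+ n)
      + 2 * (- 3 * Q - 4 * a 3 * Q4) ^+ n
      + (- 3 * Q + 4 * a 3 * Q4 + 8 * a 4 * Q38 * 'i) ^+ n
      + (- 3 * Q + 4 * a 3 * Q4 - 8 * a 4 * Q38 * 'i) ^+ n))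
  /\
  ((5 <= m)%N ->
   N%:R = (q ^ n.-1)%N%:R + (q.-1)%:R / (2 ^ m * q)%N%:R *
     ((2 ^ (m - 2))%N%:R * ((Q + 4 * b 3 * Q4) ^+ n + (Q - 4 * b 3 * Q4) ^+ n)
      + (2 ^ (m - 3))%N%:R * ((Q + 8 * b 4 * Q38) ^+ n + (Q - 8 * b 4 * Q38) ^+ n)
      + (\sum_(2 <= t < m - 3)
          (2 ^ (m - t - 2))%N%:R *
          ((- 3 * Q + Ssum t
            - (2 ^ t)%N%:R * a t.+1 * qpow q (2 ^ (t - 1) - 1)%N (2 ^ t)%N
            + (2 ^ (t + 2))%N%:R * b (t + 3)%N * qpow q (2 ^ (t + 1) - 1)%N (2 ^ (t + 2))%N) ^+ n
         + (- 3 * Q + Ssum t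
            - (2 ^ t)%N%:R * a t.+1 * qpow q (2 ^ (t - 1) - 1)%N (2 ^ t)%N
            - (2 ^ (t + 2))%N%:R * b (t + 3)%N * qpow q (2 ^ (t + 1) - 1)%N (2 ^ (t + 2))%N) ^+ n))
      + 2 * ((- 3 * Q + Ssum (m - 3)%N
              - (2 ^ (m - 3))%N%:R * a (m - 2)%N * qpow q (2 ^ (m - 4) - 1)%N (2 ^ (m - 3))%N
              + (2 ^ (m - 1))%N%:R * b m * qpow q (2 ^ (m - 2) - 1)%N (2 ^ (m - 1))%N * 'i) ^+ n
           + (- 3 * Q + Ssum (m - 3)%N
              - (2 ^ (m - 3))%N%:R * a (m - 2)%N * qpow q (2 ^ (m - 4) - 1)%N (2 ^ (m - 3))%N
              - (2 ^ (m - 1))%N%:R * b m * qpow q (2 ^ (m - 2) - 1)%N (2 ^ (m - 1))%N * 'i) ^+ n)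
      + 2 * (- 3 * Q + Ssum (m - 2)%N
             - (2 ^ (m - 2))%N%:R * a (m - 1)%N * qpow q (2 ^ (m - 3) - 1)%N (2 ^ (m - 2))%N) ^+ n
      + (- 3 * Q + Ssum (m - 1)%N
         + (2 ^ (m - 1))%N%:R * a m * qpow q (2 ^ (m - 2) - 1)%N (2 ^ (m - 1))%N * 'i) ^+ n
      + (- 3 * Q + Ssum (m - 1)%N
         - (2 ^ (m - 1))%N%:R * a m * qpow q (2 ^ (m - 2) - 1)%N (2 ^ (m - 1))%N * 'i) ^+ n)).
Proof.
move=> p_pr p3 s_gt0 -> cardF m3 dvq ndvq n_gt0 HAB N Q Q4 Q38 a b Ssum.
rewrite -cardF in dvq ndvq.
have [g Hg] := exists_generator F.
have [zp Hzp] := C_prim_root_exists (prime_gt0 p_pr).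
have [z Hz] := C_prim_root_exists (expn_gt0 2 m : (0 < 2 ^ m)%N).
split; [move=> m_eq3 | split=> [m_eq4|m_ge5]].
- by rewrite /N (count_m3 p_pr p3 s_gt0 cardF m3 dvq ndvq Hg Hzp Hz HAB n_gt0 m_eq3).
- by rewrite /N (count_m4 p_pr p3 s_gt0 cardF m3 dvq ndvq Hg Hzp Hz HAB n_gt0 m_eq4).
- exact: (count_ge5 p_pr p3 s_gt0 cardF m3 dvq ndvq Hg Hzp Hz HAB n_gt0 m_ge5).
Qed.
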